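(* There exists $\varepsilon_0\in(0,1)$ such that for every $0<\varepsilon<\varepsilon_0$ and every integer $\iota\ge2$ there exists a residual set $\mathcal{R}\subset[0,1]$ such that for every $\alpha\in\mathcal{R}$ and every $\delta>0$, $$\left(U_\delta^{\iota-\varepsilon}\setminus U_\delta^{\iota}\right)\cap\left(\Phi(\mathcal{O}_\alpha^{\omega,0})\setminus\Phi(\mathcal{O}_\alpha^{\omega,\mathrm{a.c.}})\right)\neq\emptyset .$$
   Context: $\mathbb{T}=\mathbb{R}/\mathbb{Z}$; functions on $\mathbb{T}$ are identified with $1$-periodic functions on $\mathbb{R}$. $C^\omega$ means real-analytic. A residual subset of $[0,1]$ is one containing a countable intersection of dense open subsets of $[0,1]$. Norms: for an integer $k\ge 0$, $\|\phi\|_{C^k}=\sum_{i=0}^k\|\phi^{(i)}\|_\infty$; for $r=k+\theta$ with $\theta\in(0,1)$, $\|\phi\|_{C^r}=\sum_{i=0}^k\|\phi^{(i)}\|_\infty+[\phi^{(k)}]_\theta$, where $[\cdot]_\theta$ is the $\theta$-Hölder seminorm. $U_\delta^r:=\{\phi\in C^\infty(\mathbb{T}) : \|\phi\|_{C^r}<\delta\}$. For $r\in\{0,\omega\}$, $D^r(\mathbb{T})$ is the set of orientation-preserving $C^r$ diffeomorphisms $f$ of $\mathbb{R}$ (homeomorphisms if $r=0$) such that $f-\mathrm{Id}$ is $1$-periodic. $D^{\mathrm{a.c.}}(\mathbb{T})$ is the set of $h\in D^0(\mathbb{T})$ such that $h-\mathrm{Id}$ is (locally) absolutely continuous. The rotation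 number is $\rho(f)=\lim_{m\to\infty}(f^m(x)-x)/m\in\mathbb{R}$. $\mathcal{F}_\alpha^\omega:=\{f\in D^\omega(\mathbb{T}):\rho(f)=\alpha\}$. With $R_\alpha(x)=x+\alpha$, for $r\in\{0,\mathrm{a.c.}\}$ put $\mathcal{O}_\alpha^{r}:=\{h^{-1}\circ R_\alpha\circ h : h\in D^r(\mathbb{T})\}$ and $\mathcal{O}_\alpha^{\omega,r}:=\mathcal{O}_\alpha^r\cap\mathcal{F}_\alpha^\omega$. The map $\Phi$ is $\Phi(g):=\frac{g+g^{-1}}{2}-\mathrm{Id}$, where $g^{-1}$ is the inverse homeomorphism. *)

(* Defs.v *)
From mathcomp Require Import all_boot all_order all_algebra.
From mathcomp Require Import all_classical all_reals all_analysis.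

Set Implicit Arguments.
Unset Strict Implicit.
Unset Printing Implicit Defensive.

Import Order.TTheory GRing.Theory Num.Theory.
Import numFieldNormedType.Exports.

Local Open Scope classical_set_scope.
Local Open Scope ring_scope.

(* The sets [U `&` X] with [U] open in [T] are the open sets of the subspace
   [X], and [U `&` X] is dense in [X] when its closure in [T] contains [X]. *)
Definition residual_in (T : topologicalType) (X A : set T) : Prop :=
  A `<=` X /\
  exists U : nat -> set T,
    [/\ forall n, open (U n),
        forall n, X `<=` closure (U n `&` X) &
        (\bigcap_n U n) `&` X `<=` A].

(* Functions on the circle R/Z are the 1-periodic functions on R. *)
Definition smooth_circle (R : realType) : set (R -> R) :=
  [set phi | periodic phi 1 /\ forall n x, derivable (derive1n n phi) x 1].

(* The norms take values in the extended reals, so that an unbounded set has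
   supremum +oo and never the junk value of the real-valued [sup]. *)
Definition sup_norm (R : realType) (phi : R -> R) : \bar R :=
  ereal_sup (range (fun x => `|phi x|%:E)).

(* On a 1-periodic function this agrees with the seminorm computed with the
   distance of R/Z, which is the least distance between lifts. *)
Definition holder_seminorm (R : realType) (theta : R) (phi : R -> R) : \bar R :=
  ereal_sup [set (`|phi p.1 - phi p.2| / `|p.1 - p.2| `^ theta)%:E
            | p in [set p : R * R | p.1 != p.2]].

(* Meant for [0 <= r]; [k] and [theta] are the integer and fractional parts. *)
Definition Cnorm (R : realType) (r : R) (phi : R -> R) : \bar R :=
  let k := Num.truncn r in
  let theta := r - k%:R in
  let Ck_norm := (\sum_(0 <= i < k.+1) sup_norm (derive1n i phi))%E in
  if theta == 0 then Ck_norm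
  else (Ck_norm + holder_seminorm theta (derive1n k phi))%E.

Definition U_ (R : realType) (r delta : R) : set (R -> R) :=
  [set phi | smooth_circle phi /\ (Cnorm r phi < delta%:E)%E].

Definition analytic_at (R : realType) (f : R -> R) (x : R) : Prop :=
  exists (a : nat -> R) (rad : R), 0 < rad /\
    forall h, `|h| < rad ->
      series (fun n => a n * h ^+ n) @ \oo --> f (x + h).

Definition analytic (R : realType) (f : R -> R) : Prop :=
  forall x, analytic_at f x.

(* Only applied to bijections of R, of which it is the two-sided inverse. *)
Definition inverse (R : realType) (f : R -> R) : R -> R := pinv setT f.

Definition D_0 (R : realType) : set (R -> R) :=
  [set f | [/\ bijective f,
               continuous f /\ continuous (inverse f),
               {homo f : x y / x < y} &
               periodic (fun x => f x - x) 1]].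

Definition D_omega (R : realType) : set (R -> R) :=
  [set f | [/\ D_0 f, analytic f & analytic (inverse f)]].

Definition abs_continuous_on (R : realType) (a b : R) (f : R -> R) : Prop :=
  forall e : R, 0 < e -> exists2 d : R, 0 < d &
    forall (n : nat) (s t : 'I_n -> R),
      (forall i, a <= s i /\ s i <= t i /\ t i <= b) ->
      trivIset setT (fun i => `]s i, t i[%classic) ->
      \sum_(i < n) (t i - s i) < d ->
      \sum_(i < n) `|f (t i) - f (s i)| < e.

Definition locally_abs_continuous (R : realType) (f : R -> R) : Prop :=
  forall a b : R, a <= b -> abs_continuous_on a b f.

Definition D_ac (R : realType) : set (R -> R) :=
  [set h | D_0 h /\ locally_abs_continuous (fun x => h x - x)].

Definition rotation_number_is (R : realType) (f : R -> R) (alpha : R) : Prop :=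
  forall x, (iter m f x - x) / m%:R @[m --> \oo] --> alpha.

Definition F_omega (R : realType) (alpha : R) : set (R -> R) :=
  [set f | D_omega f /\ rotation_number_is f alpha].

Definition rotation (R : realType) (alpha : R) : R -> R := fun x => x + alpha.

Definition conj_rotations (R : realType) (D : set (R -> R)) (alpha : R) :
    set (R -> R) :=
  [set inverse h \o rotation alpha \o h | h in D].

Definition O_omega_0 (R : realType) (alpha : R) : set (R -> R) :=
  conj_rotations (@D_0 R) alpha `&` F_omega alpha.

Definition O_omega_ac (R : realType) (alpha : R) : set (R -> R) :=
  conj_rotations (@D_ac R) alpha `&` F_omega alpha.

Definition Phi (R : realType) (g : R -> R) : R -> R :=
  fun x => (g x + inverse g x) / 2 - x.

(* Main.v *)
(** Take the lift [f_t(x) = x + t + psi(N x) / N] of a circle map, where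
    [z -> lambda z^2 (1 - b z) / (z - b)] is the action of [x + t + psi(x)] on
    [z = exp(2 pi i x)].  It is analytic, and for irrational [alpha] some [f_t]
    has rotation number [alpha] and is conjugate to the rotation, by Denjoy.

    The conjugacy [h] is singular when [alpha] is slightly above some [p/q], for
    infinitely many [p/q]: at the least [t] with [f_t^q >= id + p] the points
    with equality are finitely many, because they are roots of a polynomial in
    [z] that does not vanish at [1/b].  Away from them [f_t^q - p] moves points
    by a definite amount, whereas it advances [h] by [q alpha - p] only; hence
    [h] grows almost entirely on small neighbourhoods of these points.

    Also [Phi(f_t)(x) = V(N x) / (2 N)] with [V] of size [b] in every [C^k], and
    with oscillation at least [b / 20] when [N alpha] is near [1/2] modulo 1.
    For [b] of order [N^(eps/2 - iota + 1)] and [N] large this is small in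
    [C^(iota - eps)] and large in [C^iota].

    Finally [Phi g = Phi g'] forces [g = g']: both maps satisfy the same second
    order recurrence, so that they agree along a dense orbit as soon as they
    agree at one point, and otherwise their rotation numbers differ. *)
Require Import Defs.
From HB Require Import structures.
From mathcomp Require Import all_boot all_order all_algebra.
From mathcomp Require Import all_classical all_reals all_analysis.
From mathcomp Require Import lra.

Set Implicit Arguments.
Unset Strict Implicit.
Unset Printing Implicit Defensive.

Import Order.TTheory GRing.Theory Num.Theory.
Import numFieldNormedType.Exports.

Local Open Scope classical_set_scope.
Local Open Scope ring_scope.

(** * Lifts of circle homeomorphisms *)

Section Lifts.
Variable R : realType.
Implicit Types (f g h : R -> R) (a x y : R) (p : int).

(** The residual set must be fixed before [delta], whereas [N] and [t] depend on [delta] and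
    [alpha]. So [b] is a function of [N] alone, singularity is demanded for every [N], and the
    closeness to [p/q] is chosen uniformly over all [t] and all conjugacies [h] with rotation number
    slightly above [p/q]. This uniformity comes from monotonicity in [t]: every such [t] is at least
    the minimal one.

    The size of [b] balances powers of [N]: the [k]-th derivative of [Phi] scales as [b N^(k-1)],
    which gives about [N^(eps/2)] in [C^iota] and [N^(-eps/2)] in [C^(iota-eps)]. For this the
    derivatives of [V], which involves the inverse map, must be bounded by [b] times constants free
    of [N] and [t]. They are computed in a finitely generated algebra of functions closed under
    derivation, which yields analyticity as well.

    The oscillation of [V] depends on [N t] rather than [N alpha], but [t] and [alpha] differ by at
    most [5 b / N]. Hence [N] can be found from the density of the multiples of [alpha], before [t]
    is known. *)

Definition lift f :=
  [/\ continuous f, {homo f : x y / x < y} & forall x, f (x + 1) = f x + 1].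

Definition irrational a :=
  forall (n : nat) p, (0 < n)%N -> n%:R * a <> p%:~R.

Lemma shift_int f : (forall x, f (x + 1) = f x + 1) ->
  forall x p, f (x + p%:~R) = f x + p%:~R.
Proof.
move=> f1.
have fn x (n : nat) : f (x + n%:R) = f x + n%:R.
  by elim: n => [|n IH]; rewrite ?addr0// -natr1 addrA f1 IH addrA.
move=> x [n|n]; first exact: fn.
rewrite NegzE mulrNz; apply/eqP; rewrite eq_sym subr_eq; apply/eqP.
by rewrite -[RHS]fn subrK.
Qed.

Lemma shift_int_iter f : (forall x, f (x + 1) = f x + 1) ->
  forall n x p, iter n f (x + p%:~R) = iter n f x + p%:~R.
Proof. by move=> f1; elim=> // n IH x p; rewrite !iterS IH shift_int. Qed.

Lemma iter_lift f n : lift f -> lift (iter n f).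
Proof.
move=> [fc fi f1]; split=> [|x y xy|x].
- elim: n => [|n IH] x /=; first exact: cvg_id.
  by apply: (@continuous_comp _ _ _ (iter n f) f); [exact: IH|exact: fc].
- by elim: n => // n IH; rewrite !iterS; exact: fi.
- by rewrite -(shift_int_iter f1 n x 1).
Qed.

Lemma lift_le f : lift f -> {mono f : x y / x <= y}.
Proof. by move=> [_ fi _]; exact: le_mono. Qed.

Lemma lift_lt f : lift f -> {mono f : x y / x < y}.
Proof. by move=> fl; apply: leW_mono; exact: lift_le. Qed.

Lemma shift_displacement f : {homo f : x y / x <= y} ->
  (forall x, f (x + 1) = f x + 1) ->
  forall x y, f x - x <= f y - y + 1.
Proof.
move=> fi f1 x y; have /andP[pl pu] := floor_itv (y - x).
have := shift_int f1 x (Num.floor (y - x) + 1).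
move: pl pu; rewrite intrD; set q := _%:~R => pl pu E.
have : f (x + q) <= f y by apply: fi; lra.
by rewrite shift_int// -/q; lra.
Qed.

(** All comparisons of long orbits below rest on this bound: iterates of a lift are lifts, so the
    error 1 does not grow with the number of iterates. *)
Lemma lift_displacement f : lift f -> forall x y, f x - x <= f y - y + 1.
Proof.
move=> fl; have [_ _ f1] := fl; apply: shift_displacement => // x y xy.
by rewrite lift_le.
Qed.

Lemma iter_ge f x p n : lift f -> x + p%:~R <= f x ->
  x + n%:R * p%:~R <= iter n f x.
Proof.
move=> fl fx; have [_ _ f1] := fl.
elim: n => [|n IH]; first by rewrite mul0r addr0.
rewrite iterS (le_trans _ (_ : f (x + n%:R * p%:~R) <= _)) ?lift_le//.
rewrite -[n%:R]/(n%:~R) -intrM shift_int// intrM -natr1 mulrDl mul1r addrCA addrC.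
by rewrite lerD2r addrC; lra.
Qed.

Lemma iter_le f x p n : lift f -> f x <= x + p%:~R ->
  iter n f x <= x + n%:R * p%:~R.
Proof.
move=> fl fx; have [_ _ f1] := fl.
elim: n => [|n IH]; first by rewrite mul0r addr0.
rewrite iterS (le_trans (_ : _ <= f (x + n%:R * p%:~R))) ?lift_le//.
rewrite -[n%:R]/(n%:~R) -intrM shift_int// intrM -natr1 mulrDl mul1r.
lra.
Qed.

Lemma iterA T (k : T -> T) m n (z : T) : iter m (iter n k) z = iter (m * n) k z.
Proof. by elim: m => //= m IH; rewrite mulSn iterD IH. Qed.

(** Both orbits are followed for the common time [n * q * q']. Their displacements then differ by at
    least [n * d], which exceeds the allowed 1 for large [n]. This compares rotation numbers without
    taking limits. *)
Lemma no_rot_conflict f q q' p p' x y : lift f ->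
  (q'%:R * p%:~R < q%:R * p'%:~R :> R) ->
  iter q f x <= x + p%:~R -> y + p'%:~R <= iter q' f y -> False.
Proof.
move=> fl lt_pq fx fy.
pose d : R := q%:R * p'%:~R - q'%:R * p%:~R.
have d0 : 0 < d by rewrite subr_gt0.
have [n nd] : exists n : nat, 1 < n%:R * d.
  exists (Num.truncn d^-1).+1.
  by rewrite -ltr_pdivrMr// div1r truncnS_gt.
have := iter_le (n * q') (iter_lift q fl) fx.
have := iter_ge (n * q) (iter_lift q' fl) fy.
rewrite !iterA -!mulnA (mulnC q' q) => A B.
have := lift_displacement (iter_lift (n * (q * q')) fl) y x.
move: nd A B; rewrite /d !natrM; lra.
Qed.

(** Dirichlet's pigeonhole: among the fractional parts of [0, a, ..., M a] two share one of [M]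
    boxes of length [1 / M], and [1 / M] is below [e]. *)
Lemma small_step a (e : R) : irrational a -> 0 < e ->
  exists (m : nat) p, (0 < m)%N /\ `|m%:R * a - p%:~R| < e.
Proof.
move=> ia e0; pose M := (Num.truncn e^-1).+1.
have Me : 1 < M%:R * e by rewrite -ltr_pdivrMr// div1r truncnS_gt.
have M0 : 0 < M%:R :> R by rewrite ltr0n.
pose fr (i : nat) : R := i%:R * a - (Num.floor (i%:R * a))%:~R.
have fr01 i : 0 <= fr i < 1.
  by have /andP[] := floor_itv (i%:R * a); rewrite intrD /fr; lra.
have frM i : (Num.truncn (M%:R * fr i) < M)%N.
  have /andP[f0 f1] := fr01 i.
  have := @truncn_itv R (M%:R * fr i) (mulr_ge0 (ltW M0) f0) => /andP[h _].
  rewrite -(@ltr_nat R); apply: le_lt_trans h _.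
  by rewrite -[ltRHS]mulr1 ltr_pM2l.
pose F (i : 'I_M.+1) : 'I_M := Ordinal (frM i).
have /injectivePn nF : ~~ injectiveb F.
  by apply/negP => /injectiveP /leq_card; rewrite !card_ord ltnn.
have [i [j [ij Fij]]] : exists i j : 'I_M.+1, (i < j)%N /\ F i = F j.
  case: nF => i [j ij Fij]; case: (ltngtP i j) => h.
  - by exists i, j.
  - by exists j, i.
  - by move: ij; rewrite (ord_inj h) eqxx.
exists (j - i)%N, (Num.floor (j%:R * a) - Num.floor (i%:R * a)).
rewrite subn_gt0; split => //.
have /andP[fi0 fi1] := fr01 i; have /andP[fj0 fj1] := fr01 j.
have := @truncn_itv R (M%:R * fr i) (mulr_ge0 (ltW M0) fi0) => /andP[ui li].
have := @truncn_itv R (M%:R * fr j) (mulr_ge0 (ltW M0) fj0) => /andP[uj lj].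
have E : Num.truncn (M%:R * fr i) = Num.truncn (M%:R * fr j).
  by have /(congr1 val) := Fij.
rewrite E in ui li.
have -> : (j - i)%:R * a - (Num.floor (j%:R * a) - Num.floor (i%:R * a))%:~R
   = fr j - fr i.
  by rewrite intrB natrB ?(ltnW ij)// /fr; lra.
rewrite -(ltr_pM2l M0) -[X in X * _]gtr0_norm// -normrM.
apply: lt_trans Me; rewrite ltr_norml.
by move: ui li uj lj; rewrite -natr1; lra.
Qed.

Lemma orbit_dense_step a (u v : R) n0 m p : (0 < m)%N -> u < v ->
  0 < m%:R * a - p%:~R < v - u ->
  exists (n : nat) q, (n0 <= n)%N /\ u < n%:R * a - q%:~R < v.
Proof.
move=> m0 uv; set s := m%:R * a - p%:~R => /andP[s0 sv].
(* [P] brings [n0 * a] below [u]; steps of length [s], shorter than the target interval, cannot jump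
   over it. *)
pose P := Num.floor (n0%:R * a - u) + 1.
have /andP[_ P1] := floor_itv (n0%:R * a - u).
pose r := (u - (n0%:R * a - P%:~R)) / s.
have r0 : 0 <= r by apply: divr_ge0; [rewrite /P; lra|exact: ltW].
have /andP[] := truncn_itv r0.
rewrite ler_pdivlMr// ltr_pdivrMr// -natr1 mulrDl mul1r => k1 k2.
exists (n0 + (Num.truncn r).+1 * m)%N, (P + (Num.truncn r).+1%:Z * p).
rewrite leq_addr; split=> //.
have -> : (n0 + (Num.truncn r).+1 * m)%:R * a
    - (P + (Num.truncn r).+1%:Z * p)%:~R
    = n0%:R * a - P%:~R + (Num.truncn r)%:R * s + s.
  by rewrite natrD natrM intrD intrM /s -!pmulrn -natr1; lra.
by move: k1 k2; lra.
Qed.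

Lemma orbit_dense a (u v : R) n0 : irrational a -> u < v ->
  exists (n : nat) p, (n0 <= n)%N /\ u < n%:R * a - p%:~R < v.
Proof.
move=> ia uv.
have uv0 : 0 < v - u by rewrite subr_gt0.
have [m [p [m0 mp]]] := small_step ia uv0.
have s0 : m%:R * a - p%:~R != 0 by rewrite subr_eq0; apply/eqP; exact: ia.
have [sp|sn] := ltP 0 (m%:R * a - p%:~R).
  by apply: (orbit_dense_step n0 m0 uv (p := p)); rewrite sp -(gtr0_norm sp).
have [||n [q [nn0 nq]]] := @orbit_dense_step (- a) (- v) (- u) n0 m (- p) m0.
- by lra.
- have {}sn : m%:R * a - p%:~R < 0 by rewrite lt_neqAle s0.
  by rewrite intrN; move: mp; rewrite ltr0_norm//; lra.
- by exists n, (- q); split=> //; move: nq; rewrite intrN; lra.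
Qed.
End Lifts.

(** * Semiconjugacy to a rotation *)

Section Semiconjugacy.
Variable R : realType.
Implicit Types (f g h : R -> R) (a x y : R) (p : int).

Lemma continuous_interval f :
  (forall x e, 0 < e -> exists u v, u < x < v /\
     forall y, u < y < v -> `|f y - f x| < e) -> continuous f.
Proof.
move=> H x; apply/cvgrPdist_lt => e e0.
have [u [v [uxv uv]]] := H x e e0.
have xi : x \in `]u, v[ by rewrite in_itv.
have := near_in_itvoo xi; apply: filterS => y /=.
by rewrite in_itv /= distrC => /uv.
Qed.

Lemma continuous_dist f x e : {for x, continuous f} -> 0 < e ->
  exists2 d, 0 < d & forall y, `|y - x| < d -> `|f y - f x| < e.
Proof.
move=> /cvgrPdist_lt fx e0; have /nbhs_ballP[d /= d0 H] := fx e e0.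
by exists d => // y yx; rewrite distrC; apply: H; rewrite /ball /= distrC.
Qed.

(** This says that the rotation number is [a] through strict inequalities at finite times, which is
    the form that orders the orbits. *)
Definition order_rot f a := forall (q : nat) p x, (0 < q)%N ->
  (p%:~R < q%:R * a -> x + p%:~R < iter q f x) /\
  (q%:R * a < p%:~R -> iter q f x < x + p%:~R).

Section Family.
Variable theta : R -> R.
Hypothesis theta_cont : continuous theta.
Hypothesis theta_per : forall x, theta (x + 1) = theta x.
Hypothesis theta_le1 : forall x, `|theta x| <= 1.
Hypothesis theta_incr : forall x y, x < y -> x + theta x < y + theta y.

Definition fam t x := x + t + theta x.

Lemma fam_lift t : lift (fam t).
Proof.
split=> [x|x y xy|x].
- apply: cvgD; last exact: theta_cont.
  by apply: cvgD; [exact: cvg_id|exact: cvg_cst].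
- by have := theta_incr xy; rewrite /fam; lra.
- by rewrite /fam theta_per; lra.
Qed.

Lemma fam_iter_le t t' n x : t <= t' -> iter n (fam t) x <= iter n (fam t') x.
Proof.
move=> tt'; elim: n => // n IH; rewrite !iterS.
apply: (@le_trans _ _ (fam t (iter n (fam t') x))).
  by rewrite (lift_le (fam_lift t)).
by rewrite /fam; lra.
Qed.

Lemma fam_iter_cont n x : continuous (fun t => iter n (fam t) x).
Proof.
elim: n => [|n IH] t; first exact: cvg_cst.
pose F t := iter n (fam t) x.
have -> : (fun t => iter n.+1 (fam t) x) = fun t => F t + t + theta (F t) by [].
apply: cvgD; first by apply: cvgD; [exact: IH|exact: cvg_id].
by apply: (@continuous_comp _ _ _ F theta); [exact: IH|exact: theta_cont].
Qed.

(** An intermediate value argument: [S] collects the parameters at which some orbit shows a rotation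
    number below [a], and its supremum is the parameter sought. *)
Lemma fam_order_rot a : exists t, order_rot (fam t) a.
Proof.
pose S := [set t | exists (q : nat) p x,
  [/\ (0 < q)%N, p%:~R < q%:R * a & iter q (fam t) x <= x + p%:~R]].
have Sub : ubound S (a + 2).
  move=> t [q [p [x [q0 pq fx]]]]; rewrite leNgt; apply/negP => ta.
  have /andP[fl fu] := floor_itv a.
  apply: (@no_rot_conflict _ _ q 1 p (Num.floor a + 1) x 0 (fam_lift t) _ fx).
    rewrite mul1r (lt_trans pq)// ltr_pM2l//; last by rewrite ltr0n.
  rewrite /= /fam add0r; move: fl fu; rewrite intrD.
  by have := theta_le1 0; rewrite ler_norml; lra.
have S0 : S !=set0.
  exists ((Num.floor a)%:~R - 2), 1%N, (Num.floor a - 1), 0; split => //.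
    by have := floor_le a; rewrite mul1r intrB; lra.
  rewrite /= /fam intrB; have := theta_le1 0; rewrite ler_norml; lra.
have hS : has_sup S by split; [|exists (a + 2)].
exists (sup S) => q p x q0; split=> [pq|pq]; rewrite ltNge; apply/negP => fx.
(* A non-strict inequality is not stable under a change of [t]. Passing to the [m]-fold iterate
   creates a slack larger than 1, and continuity in [t] may spend 1 of it. *)
- have [m md] : exists m : nat, 1 < m%:R * (q%:R * a - p%:~R).
    exists (Num.truncn (q%:R * a - p%:~R)^-1).+1.
    by rewrite -ltr_pdivrMr ?subr_gt0// div1r truncnS_gt.
  have := iter_le m (iter_lift q (fam_lift (sup S))) fx; rewrite iterA => fmx.
  have [d d0 H] := @continuous_dist (fun t => iter (m * q) (fam t) x) (sup S)
    1 (@fam_iter_cont (m * q) x (sup S)) ltr01.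
  have : S (sup S + d / 2).
    exists (m * q)%N, (m%:Z * p + 1), x; split.
    + rewrite muln_gt0 q0 andbT lt0n; apply/eqP => m0.
      by move: md; rewrite m0 mul0r; lra.
    + by rewrite natrM intrD intrM -pmulrn; move: md; lra.
    + have /H : `|sup S + d / 2 - sup S| < d by rewrite addrC addKr gtr0_norm; lra.
      by rewrite intrD intrM -pmulrn ltr_norml; move: fmx; lra.
  by move=> /(ub_le_sup hS.2); lra.
- have [m md] : exists m : nat, 1 < m%:R * (p%:~R - q%:R * a).
    exists (Num.truncn (p%:~R - q%:R * a)^-1).+1.
    by rewrite -ltr_pdivrMr ?subr_gt0// div1r truncnS_gt.
  have := iter_ge m (iter_lift q (fam_lift (sup S))) fx; rewrite iterA => fmx.
  have [d d0 H] := @continuous_dist (fun t => iter (m * q) (fam t) x) (sup S)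
    1 (@fam_iter_cont (m * q) x (sup S)) ltr01.
  have [t0 St0 td] := sup_adherent d0 hS.
  have t0S := ub_le_sup hS.2 St0.
  have [q' [p' [y [q'0 pq' fy]]]] := St0.
  apply: (@no_rot_conflict _ _ q' (m * q) p' (m%:Z * p - 1) y x (fam_lift t0)
    _ fy).
    have q'p : 0 < q'%:R :> R by rewrite ltr0n.
    have m0 : 0 < (m * q)%:R :> R.
      rewrite ltr0n muln_gt0 q0 andbT lt0n; apply/eqP => m0.
      by move: md; rewrite m0 mul0r; lra.
    have := pq'; rewrite -(ltr_pM2l m0) => /lt_trans; apply.
    rewrite mulrCA ltr_pM2l// natrM intrB intrM -pmulrn; move: md; lra.
  have /H : `|t0 - sup S| < d by rewrite ltr_norml; lra.
  rewrite intrB intrM -pmulrn ltr_norml; move: fmx; lra.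
Qed.

End Family.

Section Order.
Variables (f : R -> R) (a : R).
Hypotheses (fl : lift f) (ia : irrational a) (fa : order_rot f a).

Let pt (q : nat) p : R := iter q f 0 - p%:~R.

(** Poincaré's observation: the translated orbit of 0 is ordered on the line like the numbers
    [q a - p]. The common iterates are stripped, and [order_rot] is applied to the remaining
    ones. *)
Let pt_lt q p q' p' :
  q%:R * a - p%:~R < q'%:R * a - p'%:~R -> pt q p < pt q' p'.
Proof.
rewrite /pt; have [qq'|q'q] := leqP q q'.
  rewrite -(subnK qq') iterD natrD; case: (posnP (q' - q)) => [->|r0].
    by move=> /=; lra.
  have [+ _] := fa (p' - p) (iter q f 0) r0.
  by rewrite intrB => H ?; have := H _; lra.
rewrite -(subnK (ltnW q'q)) iterD natrD.
have r0 : (0 < q - q')%N by rewrite subn_gt0.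
have [_ +] := fa (p - p') (iter q' f 0) r0.
by rewrite intrB => H ?; have := H _; lra.
Qed.

(** A semiconjugacy fixing 0 must send [pt q p] to [q a - p]; the supremum of this set extends that
    assignment monotonically. *)
Let below x : set R :=
  [set z | exists (q : nat) p, z = q%:R * a - p%:~R /\ pt q p <= x].

Let below_sup x : has_sup (below x).
Proof.
have /andP[xl xu] := floor_itv x; split.
  exists (0%:R * a - (- Num.floor x)%:~R), 0%N, (- Num.floor x).
  by rewrite /pt /= intrN; split=> //; lra.
exists (Num.floor x + 1)%:~R => _ [q [p [-> qp]]].
rewrite leNgt; apply/negP => H.
have := @pt_lt 0%N (- (Num.floor x + 1)) q p.
rewrite {1}/pt /= intrN opprK mul0r; move: xu; lra.
Qed.

Let h x := sup (below x).

Let h_ge q p x : pt q p <= x -> q%:R * a - p%:~R <= h x.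
Proof. by move=> qp; apply: (ub_le_sup (below_sup x).2); exists q, p. Qed.

Let h_le x (z : R) :
  (forall q p, pt q p <= x -> q%:R * a - p%:~R <= z) -> h x <= z.
Proof.
by move=> H; apply: (ge_sup (below_sup x).1) => _ [q [p [-> qp]]]; exact: H.
Qed.

Let h_pt q p x : x <= pt q p -> h x <= q%:R * a - p%:~R.
Proof.
move=> xq; apply: h_le => q' p' q'x; rewrite leNgt; apply/negP => /pt_lt.
by rewrite ltNge (le_trans q'x).
Qed.

Let h_homo : {homo h : x y / x <= y}.
Proof. by move=> x y xy; apply: h_le => q p qx; apply: h_ge; lra. Qed.

Let h1 x : h (x + 1) = h x + 1.
Proof.
apply/eqP; rewrite eq_le; apply/andP; split.
  apply: h_le => q p qx; have := @h_ge q (p + 1) x.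
  by rewrite /pt intrD; move: qx; rewrite /pt => ? H; have := H _; lra.
rewrite -lerBrDr; apply: h_le => q p qx; have := @h_ge q (p - 1) (x + 1).
by rewrite /pt intrB; move: qx; rewrite /pt => ? H; have := H _; lra.
Qed.

Let h_f x : h (f x) = h x + a.
Proof.
have [_ _ f1] := fl.
have fS q p y : pt q.+1 p <= f y -> q.+1%:R * a - p%:~R <= h y + a.
  have -> : pt q.+1 p = f (pt q p).
    by rewrite /pt iterS -intrN shift_int// intrN.
  by rewrite lift_le// => /h_ge; rewrite -natr1; lra.
apply/eqP; rewrite eq_le; apply/andP; split.
  (* Only forward iterates occur in [pt], so an integer point ([q = 0]) is not the image under [f]
     of another such point. Density supplies points with [q > 0] slightly below it. *)
  apply: h_le => -[|q] p; last exact: fS.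
  move=> px; rewrite leNgt; apply/negP => H.
  have [n [r [n0 /andP[nr1 nr2]]]] := orbit_dense 1 ia H.
  case: n n0 nr1 nr2 => // n _ nr1 nr2.
  have : pt n.+1 r <= f x by apply: le_trans px; apply/ltW/pt_lt.
  by move/fS; lra.
rewrite -lerBrDr; apply: h_le => q p qx; rewrite lerBrDr.
have : pt q.+1 p <= f x.
  have -> : pt q.+1 p = f (pt q p).
    by rewrite /pt iterS -intrN shift_int// intrN.
  by rewrite lift_le.
by move/h_ge; rewrite -natr1; lra.
Qed.

(** A monotone map has no jump if its values are dense: two orbit points with values within [e] of
    [h x] enclose [x]. *)
Let h_cont : continuous h.
Proof.
apply: continuous_interval => x e e0.
have e1 : h x - e < h x by lra.
have e2 : h x < h x + e by lra.
have [n [p [_ np]]] := orbit_dense 0 ia e1.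
have [m [r [_ mr]]] := orbit_dense 0 ia e2.
exists (pt n p), (pt m r); split.
  apply/andP; split; rewrite ltNge; apply/negP.
    by move/h_pt; lra.
  by move/h_ge; lra.
move=> y /andP[/ltW/h_ge ny /ltW/h_pt ym]; rewrite ltr_norml; lra.
Qed.

Lemma semiconjugacy : exists h, [/\ continuous h, {homo h : x y / x <= y},
  forall x, h (x + 1) = h x + 1 & forall x, h (f x) = h x + a].
Proof. by exists h. Qed.

End Order.
End Semiconjugacy.

(** * Denjoy's theorem *)

Section Denjoy.
Variable R : realType.

Lemma disjoint_total_length n (s t : 'I_n -> R) (c : R) : 0 <= c ->
  (forall i, [/\ 0 <= s i, s i <= t i & t i <= c]) ->
  trivIset setT (fun i => `[s i, t i]%classic) ->
  \sum_(i < n) (t i - s i) <= c.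
Proof.
move=> c0 st tr; rewrite -lee_fin -sumEFin.
have lE (u v : R) : u <= v -> lebesgue_measure `[u, v]%classic = (v - u)%:E.
  rewrite le_eqVlt lebesgue_measure_itv /= lte_fin => /predU1P[->|uv].
    by rewrite ltxx subrr.
  by rewrite uv EFinB.
rewrite (eq_bigr (fun i => lebesgue_measure `[s i, t i]%classic)); last first.
  by move=> i _; have [_ ? _] := st i; rewrite lE.
have mst i : measurable (`[s i, t i]%classic : set R) by exact: measurable_itv.
rewrite -measure_semi_additive_ord//=; last first.
  by apply: bigsetU_measurable => i _; exact: mst.
rewrite -[leRHS]/((c%:E)) -[c in leRHS]subr0 -lE//.
apply: le_measure; rewrite ?inE.
- by apply: bigsetU_measurable => i _; exact: mst.
- exact: measurable_itv.
apply: (big_ind (fun X : set R => X `<=` `[0, c]%classic)) => [//|X Y XI YI|i _ x].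
  by rewrite subUset.
have [s0 _ tc] := st i; rewrite /= !in_itv /= => /andP[x1 x2].
by rewrite (le_trans s0 x1) (le_trans x2 tc).
Qed.

Lemma bounded_sum_small (l : nat -> R) (c e : R) : (forall i, 0 <= l i) ->
  (forall n, \sum_(i < n) l i <= c) -> 0 < e ->
  exists n0, forall n, (n0 <= n)%N -> l n < e.
Proof.
move=> l0 lc e0.
have cv : cvgn (series l).
  apply: nondecreasing_is_cvgn.
    by apply: nondecreasing_series => n _ _; exact: l0.
  by exists c => _ [n _ <-]; rewrite /series /= big_mkord; exact: lc.
have /cvgrPdist_lt/(_ e e0)[N _ H] := cvg_series_cvg_0 cv.
exists N => n /H /=; rewrite sub0r normrN; exact/le_lt_trans/ler_norm.
Qed.

Variables (f h : R -> R) (a L : R).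
Hypotheses (fl : lift f) (ia : irrational a) (L0 : 0 <= L).
Hypotheses (hc : continuous h) (hm : {homo h : x y / x <= y}).
Hypotheses (h1 : forall x, h (x + 1) = h x + 1).
Hypothesis hf : forall x, h (f x) = h x + a.
(** Bounded distortion in derivative-free form: the mean slopes of [f] over two adjacent intervals
    have a ratio of at most [1 + L] times their total length. *)
Hypothesis distortion : forall x y z, x < y -> y < z ->
  (f y - f x) * (z - y) <= (1 + L * (z - x)) * ((f z - f y) * (y - x)).

Lemma semiconj_iter n x : h (iter n f x) = h x + n%:R * a.
Proof.
elim: n => [|n IH]; first by rewrite mul0r addr0.
by rewrite iterS hf IH -natr1; lra.
Qed.

Lemma no_flat_piece x y : x < y -> h x <> h y.
Proof.
move=> xy hxy; pose v := h x; pose Z := [set z | h z = v].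
have Zx : Z x by [].
have Zlb : lbound Z (x - 1).
  move=> z hz; rewrite leNgt; apply/negP => zx.
  have : h (z + 1) <= h x by apply: hm; lra.
  by rewrite h1 hz /v; lra.
have hZ : has_inf Z by split; [exists x|exists (x - 1)].
(* The left end of the plateau of [h]. To the left of it [h] is strictly smaller, which makes a
   close return from the left strictly lower [h]. *)
pose A := inf Z.
have Ax : A <= x by exact: (ge_inf hZ.2).
have hA : h A = v.
  apply/eqP; rewrite eq_le hm//= leNgt; apply/negP => hAv.
  have e0 : 0 < v - h A by rewrite subr_gt0.
  have [d d0 H] := continuous_dist (hc (x := A)) e0.
  have [z hz zA] := inf_adherent d0 hZ.
  have Az := ge_inf hZ.2 hz.
  have : `|z - A| < d by rewrite ltr_norml; move: zA Az; rewrite -/A; lra.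
  by move=> /H; rewrite hz ltr_norml; lra.
have ltA u : u < A -> h u < v.
  move=> uA; rewrite lt_neqAle -{2}hA hm ?(ltW uA)// andbT; apply/eqP => hu.
  by have := ge_inf hZ.2 hu; rewrite -/A leNgt uA.
have Ay : A < y by lra.
have hy : h y = v by [].
have f_lt n := lift_lt (iter_lift n fl).
pose l n := iter n f y - iter n f A.
have l_gt0 n : 0 < l n by rewrite subr_gt0 f_lt.
have l_le1 n : l n <= 1.
  rewrite leNgt; apply/negP; rewrite /l => H.
  have : h (iter n f A + 1) <= h (iter n f y) by apply: hm; lra.
  by rewrite h1 !semiconj_iter hA hy; lra.
(* The images of the plateau are translated so as to start in [[0, 1[]; having length at most 1 they
   lie in [[0, 2]]. They are disjoint because [h] is constant on each, with distinct values by
   irrationality. *)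
have sum_l n : \sum_(i < n) l i <= 2.
  pose s (i : 'I_n) := iter i f A - (Num.floor (iter i f A))%:~R.
  pose t (i : 'I_n) := iter i f y - (Num.floor (iter i f A))%:~R.
  rewrite (eq_bigr (fun i => t i - s i)); last by move=> i _; rewrite /l /t /s; lra.
  apply: disjoint_total_length => // [i|].
    have /andP[] := floor_itv (iter i f A); rewrite intrD.
    have := l_gt0 i; have := l_le1 i; rewrite /l /s /t; split; lra.
  apply/trivIsetP => i j _ _ ij; rewrite -subset0 => z [/=].
  rewrite !in_itv /=.
  have hz k : s k <= z <= t k ->
      h z = v + k%:R * a - (Num.floor (iter k f A))%:~R.
    move=> /andP[/hm sz /hm zt]; apply/eqP.
    move: sz zt; rewrite /s /t -intrN !(shift_int h1) !semiconj_iter hA hy.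
    by rewrite eq_le => -> ->.
  move=> /hz zi /hz zj.
  have neq (k m : nat) (p q : int) : (k < m)%N ->
      k%:R * a - p%:~R = m%:R * a - q%:~R -> False.
    move=> km E; apply: (ia (n := (m - k)%N) (p := q - p)).
      by rewrite subn_gt0.
    by rewrite natrB ?(ltnW km)// intrB; lra.
  have E : i%:R * a - (Num.floor (iter i f A))%:~R
      = j%:R * a - (Num.floor (iter j f A))%:~R by move: zi zj; lra.
  by move: ij; rewrite neq_ltn => /orP[] /neq; apply; [exact: E|exact: esym E].
(* Schwartz's argument: the images of the flat piece [A, y] have bounded total
   length, so that those of a short left neighbour [A - eta, A] stay less than
   half as long.  A close return then moves [A - eta] to the right, although it
   lowers [h]. *)
pose k := (2 * expR (4 * L))^-1.
have k0 : 0 < k by rewrite invr_gt0 mulr_gt0 ?expR_gt0.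
pose eta := (y - A) * k.
have eta0 : 0 < eta by rewrite mulr_gt0// subr_gt0.
pose X n := iter n f A - iter n f (A - eta).
pose sg n := \sum_(i < n) l i.
have X_gt0 n : 0 < X n by rewrite subr_gt0 f_lt; lra.
(* Since [sg n] is at most 2, the accumulated distortion is at most [expR (4 * L)], and [k] is half
   the inverse of that. *)
have half n : expR (2 * L * sg n) * k <= 2^-1.
  rewrite /k invfM mulrCA ler_piMr// ler_pdivrMr ?expR_gt0// mul1r ler_expR.
  by have := ler_wpM2l L0 (sum_l n); rewrite -/(sg n); lra.
have X_le n : X n <= expR (2 * L * sg n) * k * l n.
  elim: n => [|n IH].
    rewrite /X /l /sg big_ord0 mulr0 expR0 mul1r /= /eta; lra.
  have Xn : X n <= l n / 2.
    by apply: (le_trans IH); rewrite mulrC ler_wpM2l ?(ltW (l_gt0 n)).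
  have A1 : iter n f (A - eta) < iter n f A by rewrite f_lt; lra.
  have A2 : iter n f A < iter n f y by rewrite f_lt.
  have := distortion A1 A2; rewrite -/(X n) -/(l n) -!iterS.
  rewrite -/(X n.+1) -/(l n.+1) => D.
  rewrite -(ler_pM2r (l_gt0 n)); apply: (le_trans D).
  (* As the left neighbour is at most half as long as the plateau image, the two together have
     length at most [2 * l n]. *)
  have E1 : 1 + L * (iter n f y - iter n f (A - eta)) <= expR (2 * L * l n).
    apply: le_trans (expR_ge1Dx _); rewrite lerD2l.
    have -> : 2 * L * l n = L * (2 * l n) by lra.
    by rewrite ler_wpM2l//; move: Xn (l_gt0 n); rewrite /X /l; lra.
  have -> : 2 * L * sg n.+1 = 2 * L * l n + 2 * L * sg n.
    by rewrite /sg big_ord_recr /=; lra.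
  rewrite expRD.
  apply: (le_trans (ler_wpM2r _ E1)).
    by rewrite mulr_ge0// ltW.
  have -> : expR (2 * L * l n) * expR (2 * L * sg n) * k * l n.+1 * l n =
    expR (2 * L * l n) * (l n.+1 * (expR (2 * L * sg n) * k * l n)) by lra.
  by rewrite !ler_wpM2l ?expR_ge0 ?(ltW (l_gt0 _)).
have [n0 small] := bounded_sum_small (fun i => ltW (l_gt0 i)) sum_l eta0.
have w0 : h (A - eta / 2) - v < 0 by rewrite subr_lt0 ltA//; lra.
have [n [p [/small ln /andP[np1 np2]]]] := orbit_dense n0 ia w0.
have P1 : A - eta / 2 < iter n f A - p%:~R.
  rewrite ltNge; apply/negP => /hm.
  by rewrite -intrN (shift_int h1) semiconj_iter hA intrN; lra.
have P2 : A - eta <= iter n f (A - eta) - p%:~R.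
  have := le_trans (X_le n) (ler_wpM2r (ltW (l_gt0 n)) (half n)).
  by move: P1; rewrite /X; lra.
have /hm := P2; rewrite -intrN (shift_int h1) semiconj_iter intrN; lra.
Qed.

End Denjoy.

(** * Conjugacies to rotations *)

Section Conjugacy.
Variable R : realType.
Implicit Types (f g h : R -> R) (a x y : R) (p : int).

Lemma lift_surj f y : lift f -> exists x, f x = y.
Proof.
move=> fl; have [fc _ f1] := fl.
have /andP[pl pu] := floor_itv (y - f 0); set p := Num.floor _ in pl pu.
have fp q : f q%:~R = f 0 + q%:~R by rewrite -(shift_int f1) add0r.
have [|||x _ <-] := @IVT _ f p%:~R (p + 1)%:~R y; last by exists x.
- by rewrite ler_int lerDl.
- exact: continuous_subspaceT.
- by rewrite !fp ge_min le_max; apply/andP; split; apply/orP; [left|right]; lra.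
Qed.

Lemma lift_inj f : lift f -> injective f.
Proof. by move=> /lift_le/inc_inj. Qed.

Lemma inverseK f x : lift f -> f (inverse f x) = x.
Proof.
by move=> fl; apply: pinvK; rewrite inE; have [y] := lift_surj x fl; exists y.
Qed.

Lemma inverseV f x : lift f -> inverse f (f x) = x.
Proof. by move=> fl; apply: (lift_inj fl); rewrite inverseK. Qed.

Lemma inverse_lift f : lift f -> lift (inverse f).
Proof.
move=> fl; have [fc _ f1] := fl.
have mono x y : x < y -> inverse f x < inverse f y.
  by move=> xy; rewrite -(lift_lt fl) !inverseK.
split=> // [|x]; last by apply: (lift_inj fl); rewrite f1 !inverseK.
apply: continuous_interval => x e e0.
exists (f (inverse f x - e)), (f (inverse f x + e)); split.
  by rewrite -{2 3}(inverseK x fl) !(lift_lt fl); lra.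
move=> y /andP[/mono + /mono]; rewrite !inverseV// ltr_norml; lra.
Qed.

Lemma lift_D0 f : lift f -> D_0 f.
Proof.
move=> fl; have [fc fi f1] := fl; split=> //.
- by exists (inverse f) => x; rewrite ?inverseV ?inverseK.
- by split=> //; have [] := inverse_lift fl.
- by move=> x; rewrite f1; lra.
Qed.

Lemma D0_lift f : D_0 f -> lift f.
Proof. by move=> [_ [fc _] fi f1]; split=> // x; have := f1 x; lra. Qed.

Lemma conj_rotationsP (D : set (R -> R)) a g : D `<=` @D_0 R ->
  conj_rotations D a g <->
  exists h, [/\ D h, lift h & forall x, h (g x) = h x + a].
Proof.
move=> DD; split=> [[h Dh <-]|[h [Dh hl hg]]].
  have hl := D0_lift (DD _ Dh); exists h; split=> // x.
  by rewrite /= inverseK.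
exists h => //; apply/funext => x; rewrite /= /rotation -hg.
by rewrite inverseV.
Qed.

(** The [n]-th iterate moves [h] by exactly [n a], and [h] measures displacements up to an error 1,
    which disappears after division by [n]. *)
Lemma conj_rotation_number g h a : lift h ->
  (forall x, h (g x) = h x + a) -> rotation_number_is g a.
Proof.
move=> hl hg x.
have hn n : h (iter n g x) = h x + n%:R * a.
  by elim: n => [|n IH]; rewrite ?mul0r ?addr0// iterS hg IH -natr1; lra.
apply/cvgrPdist_le => e e0; near=> n.
have n0 : 0 < n%:R :> R by rewrite ltr0n; near: n; exact: nbhs_infty_gt.
have -> : a - (iter n g x - x) / n%:R = (n%:R * a - (iter n g x - x)) / n%:R.
  by rewrite [in RHS]mulrBl mulrAC divff ?mul1r// gt_eqF.
rewrite normrM normfV (gtr0_norm n0) ler_pdivrMr//.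
apply: (@le_trans _ _ 1).
  have := lift_displacement hl x (iter n g x).
  have := lift_displacement hl (iter n g x) x.
  by rewrite ler_norml hn; lra.
rewrite -ler_pdivrMl// mulr1.
by near: n; exact: nbhs_infty_ger.
Unshelve. all: end_near. Qed.

Lemma periodic_reduce (f : R -> R) x : (forall x, f (x + 1) = f x) ->
  exists2 y, 0 <= y < 1 & f y = f x.
Proof.
move=> f1; have /andP[pl pu] := floor_itv x.
exists (x - (Num.floor x)%:~R); first by move: pl pu; rewrite intrD; lra.
have F z : f (z + 1) + (z + 1) = f z + z + 1 by rewrite f1 addrA.
have := @shift_int _ (fun z => f z + z) F x (- Num.floor x).
by rewrite intrN; lra.
Qed.

Lemma periodic_pos_lower (f : R -> R) : continuous f ->
  (forall x, f (x + 1) = f x) -> (forall x, 0 < f x) ->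
  exists2 c, 0 < c & forall x, c <= f x.
Proof.
move=> fc f1 f0.
have [||c _ cmin] := @EVT_min _ f 0 1 => //; first exact: continuous_subspaceT.
exists (f c) => // x; have [y /andP[y0 y1] <-] := periodic_reduce x f1.
by apply: cmin; rewrite in_itv /= y0 ltW.
Qed.

(** By compactness the excess over [a] is at least some [c > 0], so [h] grows by [n (a + c)] along
    an orbit along which [h'] grows by [n a]. Each is within 1 of the displacement of the orbit,
    which forces [n c <= 2]. *)
Lemma conj_rotation_no_gt g h h' a : lift g -> lift h -> lift h' ->
  (forall x, h x + a < h (g x)) -> (forall x, h' (g x) = h' x + a) -> False.
Proof.
move=> gl hl h'l hg h'g; have [gc _ g1] := gl; have [hc _ h1] := hl.
pose D x := h (g x) - h x - a.
have [|||c c0 Dc] := @periodic_pos_lower D.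
- move=> x; apply: cvgB; last exact: cvg_cst.
  by apply: cvgB; [apply: continuous_comp; [exact: gc|exact: hc]|exact: hc].
- by move=> x; rewrite /D g1 !h1; lra.
- by move=> x; rewrite /D; have := hg x; lra.
have hn n : h 0 + n%:R * (a + c) <= h (iter n g 0).
  elim: n => [|n IH]; first by rewrite mul0r addr0.
  by rewrite iterS; have := Dc (iter n g 0); rewrite /D -natr1; lra.
have h'n n : h' (iter n g 0) = h' 0 + n%:R * a.
  by elim: n => [|n IH]; rewrite ?mul0r ?addr0// iterS h'g IH -natr1; lra.
pose n := (Num.truncn (2 * c^-1)).+1.
have : 2 < n%:R * c by rewrite -ltr_pdivrMr// truncnS_gt.
have := hn n; have := h'n n.
have := lift_displacement hl (iter n g 0) 0.
have := lift_displacement h'l 0 (iter n g 0).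
by lra.
Qed.

Lemma nonvanishing_pos (f : R -> R) x y : continuous f ->
  (forall z, f z != 0) -> 0 < f x -> 0 < f y.
Proof.
move=> fc nz fx; rewrite ltNge; apply/negP => fy.
have [|||c _ fc0] := @IVT _ f (Num.min x y) (Num.max x y) 0.
- by rewrite ge_min !le_max !lexx.
- exact: continuous_subspaceT.
- by case: (leP x y) => _; rewrite ge_min le_max fy (ltW fx) ?orbT.
- by have := nz c; rewrite fc0 eqxx.
Qed.

Lemma Phi_inj g g' h h' a : irrational a ->
  lift g -> lift g' -> lift h -> lift h' ->
  (forall x, h (g x) = h x + a) -> (forall x, h' (g' x) = h' x + a) ->
  Phi g = Phi g' -> g = g'.
Proof.
move=> ia gl g'l hl h'l hg h'g' PP.
have [gc _ g1] := gl; have [g'c _ g'1] := g'l; have [hc _ h1] := hl.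
have P x : g x + inverse g x = g' x + inverse g' x.
  by have := congr1 (fun F => F x) PP; rewrite /Phi; lra.
have [[x0 gx0]|ne] := pselect (exists x0, g x0 = g' x0).
- have E n : g (iter n g x0) = g' (iter n g x0).
    elim: n => // n IH; have := P (iter n.+1 g x0); rewrite iterS inverseV//.
    by have -> : inverse g' (g (iter n g x0)) = iter n g x0;
      [rewrite IH inverseV|lra].
  apply/funext => x; apply/eqP; rewrite -subr_eq0; apply/negPn/negP => nz.
  have ez : 0 < `|g x - g' x| by rewrite normr_gt0.
  have [d d0 H] := @continuous_dist _ (fun z => g z - g' z) x _
    (cvgB (gc x) (g'c x)) ez.
  have hd : h (x - d) - h x0 < h (x + d) - h x0.
    by rewrite ltrD2r (lift_lt hl); lra.
  have [n [p [_ /andP[np1 np2]]]] := orbit_dense 0 ia hd.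
  have hn : h (iter n g x0 - p%:~R) = h x0 + n%:R * a - p%:~R.
    rewrite -intrN (shift_int h1) intrN; congr (_ - _).
    elim: (n) => [|m IH]; first by rewrite mul0r addr0.
    by rewrite iterS hg IH -natr1; lra.
  have : `|iter n g x0 - p%:~R - x| < d.
    have lo : x - d < iter n g x0 - p%:~R by rewrite -(lift_lt hl) hn; lra.
    have up : iter n g x0 - p%:~R < x + d by rewrite -(lift_lt hl) hn; lra.
    by rewrite ltr_norml; lra.
  move=> /H; rewrite -intrN (shift_int g1) (shift_int g'1) E.
  have -> : g' (iter n g x0) + (- p)%:~R - (g' (iter n g x0) + (- p)%:~R) = 0.
    by lra.
  by rewrite sub0r normrN ltxx.
(* The difference has constant sign. The conjugacy of the smaller map then advances by more than [a]
   under the larger one, which is itself conjugate to the rotation by [a]. *)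
- have nz x : g x - g' x != 0.
    by rewrite subr_eq0; apply/eqP => gx; apply: ne; exists x.
  have gg'c : continuous (fun z => g z - g' z).
    by move=> z; apply: cvgB; [exact: gc|exact: g'c].
  exfalso; have [g0|g0] := ltP 0 (g 0 - g' 0).
    apply: (@conj_rotation_no_gt g h' h a) => // x.
    rewrite -h'g' (lift_lt h'l) -subr_gt0.
    exact: (nonvanishing_pos (f := fun z => g z - g' z) _ gg'c nz g0).
  apply: (@conj_rotation_no_gt g' h h' a) => // x.
  rewrite -hg (lift_lt hl) -subr_gt0.
  apply: (@nonvanishing_pos (fun z => g' z - g z) 0 x).
  - by move=> z; apply: cvgB; [exact: g'c|exact: gc].
  - by move=> z; rewrite -opprB oppr_eq0.
  - by rewrite lt_neqAle eq_sym -opprB oppr_eq0 nz oppr_ge0.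
Qed.

End Conjugacy.

(** * Singular conjugacies near rational rotation numbers *)

Section Singular.
Variable R : realType.
Implicit Types (f g h : R -> R) (a x y : R) (p : int).

(** Steps of length at least [eta] carry [u] across [[u, v]] in [n] moves, and every move raises [h]
    by exactly [b]. *)
Lemma crossing h phi (u v eta b : R) n : {homo h : x y / x <= y} -> 0 <= b ->
  (forall x, h (phi x) = h x + b) ->
  (forall x, u <= x <= v -> x + eta <= phi x) ->
  v <= u + n%:R * eta -> h v - h u <= n%:R * b.
Proof.
move=> hm b0 hphi; elim: n u => [|n IH] u step; rewrite ?mul0r ?addr0.
  by move/hm; rewrite subr_le0.
move=> vu; have n0 : 0 <= n%:R * b by rewrite mulr_ge0.
have [uv|/ltW vu'] := leP u v; last first.
  by have := hm _ _ vu'; rewrite -natr1; lra.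
have pu : u + eta <= phi u by apply: step; rewrite lexx.
have [pv|vp] := leP (phi u) v; last first.
  by have := hm _ _ (ltW vp); rewrite hphi -natr1; lra.
have [eta0|eta0] := leP 0 eta.
  have := IH (phi u) _ _; rewrite hphi -natr1 => H.
  suff : h v - (h u + b) <= n%:R * b by lra.
  apply: H => [x /andP[px xv]|].
    by apply: step; rewrite xv (le_trans _ px)//; lra.
  by move: vu; rewrite -natr1; lra.
have : v <= u.
  apply: le_trans vu _; rewrite gerDl.
  by rewrite mulr_ge0_le0// ltW.
by move/hm; rewrite -natr1; lra.
Qed.

Definition piece (M j : nat) : interval R := `[j%:R / M%:R, j.+1%:R / M%:R].

(** The factor 2 comes from closed pieces: a grid point belongs to two of them, with indices [m] and
    [m - 1]. *)
Lemma pieces_near_points (M : nat) (zs : seq R) : (0 < M)%N ->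
  (#|[set j : 'I_M | has (mem (piece M j)) zs]%SET| <= 2 * size zs)%N.
Proof.
move=> M0; have M0' : 0 < M%:R :> R by rewrite ltr0n.
elim: zs => [|z zs IH].
  have -> : [set j : 'I_M | has (mem (piece M j)) [::]]%SET = finset.set0.
    by apply/finset.setP => j; rewrite !inE.
  by rewrite cards0.
pose m := Num.truncn (z * M%:R).
pose A (k : nat) := [set j : 'I_M | (j : nat) == k]%SET.
have A1 k : (#|A k| <= 1)%N.
  apply/card_le1_eqP => i j; rewrite !inE => /eqP ik /eqP jk.
  by apply: ord_inj; rewrite ik jk.
apply: (@leq_trans #|A m :|: A m.-1 :|: [set j : 'I_M | has (mem (piece M j)) zs]|%SET).
  apply: subset_leq_card; apply/fintype.subsetP => j; rewrite !inE /= => /orP[zj|->].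
    move: zj; rewrite in_itv /= ler_pdivrMr// ler_pdivlMr// => /andP[jz zj].
    have z0 : 0 <= z * M%:R by apply: le_trans jz.
    have /andP[m1 m2] := truncn_itv z0.
    have jm : (j <= m)%N by rewrite truncn_ge_nat.
    have mj : (m <= j.+1)%N.
      by rewrite -(@ler_nat R); apply: le_trans m1 _.
    move: jm mj; rewrite leq_eqVlt => /predU1P[->|jm mj]; first by rewrite eqxx.
    have -> : m = j.+1 by apply/eqP; rewrite eqn_leq mj.
    by rewrite eqxx orbT.
  by rewrite orbT.
rewrite /= mulnS; apply: leq_trans (leq_card_setU _ _) _; apply: leq_add => //.
by apply: leq_trans (leq_card_setU _ _) _; rewrite -[2%N]/(1 + 1)%N leq_add.
Qed.

Lemma sum_pieces h (M : nat) : (0 < M)%N ->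
  \sum_(j < M) (h (j.+1%:R / M%:R) - h (j%:R / M%:R)) = h 1 - h 0.
Proof.
move=> M0; have := @telescope_sumr _ 0 M (fun j => h (j%:R / M%:R)) (leq0n _).
by rewrite big_mkord mul0r divff ?pnatr_eq0 -?lt0n.
Qed.

Lemma not_abs_continuous h : (forall d : R, 0 < d ->
    exists (M : nat) (B : {set 'I_M}), [/\ (0 < M)%N, #|B|%:R < d * M%:R &
      2^-1 <= \sum_(j in B) (h (j.+1%:R / M%:R) - h (j%:R / M%:R))]) ->
  ~ locally_abs_continuous (fun x => h x - x).
Proof.
(* The pieces of [B] carry at least 1/2 of the growth of [h] and have total length below 1/4, so
   [h - id] still grows by at least 1/4 on them. *)
move=> H /(_ 0 1 ler01 4^-1) [|d d0 ac]; first by rewrite invr_gt0.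
have [|M [B [M0 Bd hB]]] := H (Num.min d 4^-1).
  by rewrite lt_min d0 invr_gt0 ltr0n.
have M0' : 0 < M%:R :> R by rewrite ltr0n.
have dB : #|B|%:R / M%:R < d.
  rewrite ltr_pdivrMr// (lt_le_trans Bd)// ler_pM2r// ge_min lexx//.
have B4 : #|B|%:R / M%:R < 4^-1 :> R.
  by rewrite ltr_pdivrMr// (lt_le_trans Bd)// ler_pM2r// ge_min lexx orbT.
pose s (j : 'I_M) : R := j%:R / M%:R.
(* Pieces outside [B] are collapsed to a point, which keeps a family indexed by all of ['I_M]
   without changing the sums. *)
pose t (j : 'I_M) : R := if j \in B then j.+1%:R / M%:R else s j.
have lS (j : nat) : j%:R / M%:R <= j.+1%:R / M%:R :> R.
  by rewrite ler_pM2r ?invr_gt0// ler_nat.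
have st j : s j <= t j by rewrite /t; case: ifP => // _; exact: lS.
have tS (j : 'I_M) : t j <= j.+1%:R / M%:R by rewrite /t; case: ifP => _ //; exact: lS.
have sumE (F : R -> R) : \sum_(j < M) (F (t j) - F (s j)) =
    \sum_(j in B) (F (j.+1%:R / M%:R) - F (j%:R / M%:R)).
  rewrite [RHS]big_mkcond; apply: eq_bigr => j _; rewrite /t.
  by case: ifP => // _; rewrite subrr.
have sumB : \sum_(j in B) (j.+1%:R / M%:R - j%:R / M%:R) = #|B|%:R / M%:R :> R.
  rewrite (eq_bigr (fun=> M%:R^-1)); last first.
    by move=> j _; rewrite -natr1 mulrDl mul1r addrAC subrr add0r.
  by rewrite sumr_const mulr_natl.
have := ac M s t; rewrite (sumE id) sumB => /(_ _ _ dB) => acM.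
suff : \sum_(i < M) `|h (t i) - t i - (h (s i) - s i)| < 4^-1.
  apply/negP; rewrite -leNgt.
  apply: (@le_trans _ _ (\sum_(i < M) (h (t i) - t i - (h (s i) - s i)))).
    rewrite (sumE (fun x => h x - x)).
    rewrite (eq_bigr (fun j : 'I_M => h (j.+1%:R / M%:R) - h (j%:R / M%:R)
      - (j.+1%:R / M%:R - j%:R / M%:R))); last by move=> j _; lra.
    by rewrite sumrB sumB; lra.
  by apply: ler_sum => i _; exact: ler_norm.
apply: acM => [i|].
  rewrite st; split; last split => //.
    by rewrite divr_ge0// ltW.
  by apply: le_trans (tS i) _; rewrite ler_pdivrMr// mul1r ler_nat.
apply/trivIsetP => i j _ _; rewrite neq_ltn -subset0 => ij x [/=].
rewrite !in_itv /= => /andP[si ti] /andP[sj tj].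
case/orP: ij => ij.
  have := lt_trans sj (lt_le_trans ti (tS i)).
  by rewrite /s ltr_pM2r ?invr_gt0// ltr_nat ltnNge ij.
have := lt_trans si (lt_le_trans tj (tS j)).
by rewrite /s ltr_pM2r ?invr_gt0// ltr_nat ltnNge ij.
Qed.

Section Family.
Variable theta : R -> R.
Hypothesis theta_cont : continuous theta.
Hypothesis theta_per : forall x, theta (x + 1) = theta x.
Hypothesis theta_le1 : forall x, `|theta x| <= 1.
Hypothesis theta_incr : forall x y, x < y -> x + theta x < y + theta y.
Local Notation ft := (fam theta).
Hypothesis finitely_periodic : forall (q : nat) p t, (0 < q)%N ->
  exists zs : seq R, forall x, 0 <= x <= 1 ->
    iter q (ft t) x = x + p%:~R -> x \in zs.

Let fl t : lift (ft t).
Proof. exact: fam_lift. Qed.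

(** The infimum is attained because the condition is closed in [t], for each fixed [x]. It is finite
    because a very negative [t] makes every step go down by more than [|p|]. *)
Lemma minimal_parameter (q : nat) p : (0 < q)%N ->
  (exists t, forall x, x + p%:~R <= iter q (ft t) x) ->
  exists2 t0, forall x, x + p%:~R <= iter q (ft t0) x &
    forall t, (forall x, x + p%:~R <= iter q (ft t) x) -> t0 <= t.
Proof.
move=> q0 T0; pose T := [set t | forall x, x + p%:~R <= iter q (ft t) x].
have lbT : lbound T (- 2 - `|p|%:~R).
  move=> t Tt; rewrite leNgt; apply/negP => tp.
  have : ft t 0 <= 0 + (- 1 - `|p|)%:~R.
    rewrite /fam intrB intrN.
    by have := theta_le1 0; rewrite ler_norml; lra.
  move=> /(iter_le q (fl t)); rewrite intrB intrN => H.
  have := Tt 0; have := ler_norm (- p); rewrite normrN -(ler_int R) intrN => pp.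
  have q1 : 1 <= q%:R :> R by rewrite ler1n.
  have p0 : 0 <= `|p|%:~R :> R by rewrite ler0z.
  have : q%:R * (- 1 - `|p|%:~R) <= 1 * (- 1 - `|p|%:~R) :> R.
    by apply: ler_wnM2r => //; lra.
  by move: H; lra.
have hT : has_inf T by split => //; exists (- 2 - `|p|%:~R).
exists (inf T) => [x|t Tt]; last exact: (ge_inf hT.2 Tt).
rewrite leNgt; apply/negP => fx.
have e0 : 0 < x + p%:~R - iter q (ft (inf T)) x by rewrite subr_gt0.
have [d d0 H] := @continuous_dist _ (fun t => iter q (ft t) x) (inf T) _
  (@fam_iter_cont _ _ theta_cont q x (inf T)) e0.
have [t Tt td] := inf_adherent d0 hT; have := ge_inf hT.2 Tt => tT.
have /H : `|t - inf T| < d by rewrite ltr_norml; lra.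
by have := Tt x; rewrite ltr_norml; lra.
Qed.

(** The bad pieces [B] and the constant [c] are read off from the minimal parameter [t0] only. Any
    admissible [t] is at least [t0], so its [q]-th iterate advances at least as much at every
    point. *)
Lemma singular_near_rational (q : nat) p (d : R) : (0 < q)%N -> 0 < d ->
  exists2 c : R, 0 < c & forall a t h, lift h ->
    (forall x, h (ft t x) = h x + a) ->
    p%:~R < q%:R * a -> q%:R * a < p%:~R + c ->
    exists (M : nat) (B : {set 'I_M}), [/\ (0 < M)%N, #|B|%:R < d * M%:R &
      2^-1 <= \sum_(j in B) (h (j.+1%:R / M%:R) - h (j%:R / M%:R))].
Proof.
move=> q0 d0.
pose T t := forall x, x + p%:~R <= iter q (ft t) x.
have inT a t h : lift h -> (forall x, h (ft t x) = h x + a) ->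
    p%:~R < q%:R * a -> T t.
  move=> hl hf pa x; have [_ _ h1] := hl.
  rewrite leNgt; apply/negP; rewrite -(lift_lt hl) (shift_int h1).
  by rewrite (semiconj_iter hf); lra.
(* If no parameter qualifies, no conjugacy satisfies [p < q a] and the claim is vacuous. *)
have [T0|nT] := pselect (exists t, T t); last first.
  by exists 1 => // a t h hl hf pa _; case: nT; exists t; exact: inT hl hf pa.
have [t0 Tt0 t0min] := minimal_parameter q0 T0.
have [zs zsP] := finitely_periodic p t0 q0.
(* At most [2 * size zs] pieces meet a possible equality point; [M] makes them a proportion below
   [d]. *)
pose M := (Num.truncn ((2 * size zs)%:R * d^-1)).+1.
have Md : (2 * size zs)%:R < d * M%:R.
  by rewrite mulrC -ltr_pdivrMr// truncnS_gt.
have M0' : 0 < M%:R :> R by rewrite ltr0n.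
pose B := [set j : 'I_M | has (mem (piece M j)) zs]%SET.
pose F x := iter q (ft t0) x - x - p%:~R.
have Fc : continuous F.
  move=> x; apply: cvgB; last exact: cvg_cst.
  apply: cvgB; last exact: cvg_id.
  by have [c _ _] := iter_lift q (fl t0); exact: c.
have piece01 (j : 'I_M) x : x \in piece M j -> 0 <= x <= 1.
  rewrite in_itv /= => /andP[jx xj].
  rewrite (le_trans _ jx) ?divr_ge0 ?(ltW M0')//= (le_trans xj)//.
  by rewrite ler_pdivrMr// mul1r ler_nat.
have good (j : 'I_M) : exists k : nat, j \notin B ->
    forall x, x \in piece M j -> 1 <= k%:R * F x.
  case: (boolP (j \in B)) => jB; first by exists 0%N.
  have jj : j%:R / M%:R <= j.+1%:R / M%:R :> R.
    by rewrite ler_pM2r ?invr_gt0// ler_nat.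
  have [|c cj cmin] := @EVT_min _ F _ _ jj; first exact: continuous_subspaceT.
  have Fc0 : 0 < F c.
    rewrite lt_neqAle; apply/andP; split; last first.
      by have := Tt0 c; rewrite /F; lra.
    apply/eqP => F0; move/negP: jB; apply; rewrite inE; apply/hasP.
    exists c => //; apply: zsP; first exact: piece01 cj.
    by move: F0; rewrite /F; lra.
  exists (Num.truncn (F c)^-1).+1 => _ x xj.
  rewrite -ler_pdivrMr ?(lt_le_trans Fc0) ?cmin// div1r.
  apply: le_trans (ltW (truncnS_gt _)).
  by rewrite lef_pV2 ?posrE ?(lt_le_trans Fc0) ?cmin.
have [k kP] := choice good.
pose K := (\max_(j < M) k j).+1.
have K0 : 0 < K%:R :> R by rewrite ltr0n.
have F0 x : 0 <= F x by have := Tt0 x; rewrite /F; lra.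
have FK (j : 'I_M) x : j \notin B -> x \in piece M j -> K%:R^-1 <= F x.
  move=> jB xj; rewrite -div1r ler_pdivrMr// mulrC (le_trans (kP j jB x xj))//.
  by rewrite ler_wpM2r// ler_nat (leq_trans (leq_bigmax j)).
(* A good piece, of length at most 1, is crossed in [K] steps of at least [1 / K], each raising [h]
   by [q a - p]. With this bound on [q a - p] the at most [M] good pieces contribute at most 1/2 of
   the total growth 1. *)
exists ((2 * M * K)%:R^-1) => [|a t h hl hf pa ap].
  by rewrite invr_gt0 ltr0n muln_gt0.
exists M, B; split => //.
  apply: le_lt_trans Md; rewrite ler_nat; exact: pieces_near_points.
have [_ _ h1] := hl.
have t0t : t0 <= t by apply: t0min; exact: inT hl hf pa.
have one : \sum_(j < M) (h (j.+1%:R / M%:R) - h (j%:R / M%:R)) = 1.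
  by rewrite sum_pieces// -[in h 1](add0r 1) h1; lra.
rewrite (bigID (mem B)) /= in one.
suff : \sum_(j < M | j \notin B) (h (j.+1%:R / M%:R) - h (j%:R / M%:R)) <= 2^-1.
  by move: one; lra.
apply: (@le_trans _ _ (\sum_(j < M | j \notin B) (K%:R * (q%:R * a - p%:~R)))).
  apply: ler_sum => j jB.
  apply: (@crossing h (fun x => iter q (ft t) x - p%:~R) _ _ K%:R^-1).
  - by move=> x y xy; rewrite (lift_le hl).
  - by lra.
  - by move=> x; rewrite -intrN (shift_int h1) (semiconj_iter hf) intrN; lra.
  - move=> x xj; have := FK j x jB; rewrite in_itv /= => /(_ xj).
    by have := fam_iter_le theta_cont theta_per theta_incr q x t0t; rewrite /F; lra.
  - rewrite mulfV ?gt_eqF// -natr1 mulrDl mul1r lerD2l.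
    by rewrite invf_le1// ler1n.
rewrite sumr_const -[leLHS]mulr_natl.
apply: (@le_trans _ _ (M%:R * (K%:R * (q%:R * a - p%:~R)))).
  rewrite ler_wpM2r ?mulr_ge0//; first by lra.
  by rewrite ler_nat (leq_trans (max_card _)) ?card_ord.
have : q%:R * a - p%:~R <= (2 * M * K)%:R^-1 by lra.
rewrite -div1r ler_pdivlMr ?ltr0n ?muln_gt0// !natrM; lra.
Qed.

End Family.
End Singular.

(** * Taylor expansion and analyticity *)

Section Calculus.
Variable R : realType.
Implicit Types (f g : R -> R) (x y : R).
Local Notation is_der x f l := (is_derive (x : R) (1 : R) (f : R -> R) l).

Lemma is_derive_add f g x (a b : R) : is_der x f a -> is_der x g b ->
  is_der x (fun y => f y + g y) (a + b).
Proof. exact: is_deriveD. Qed.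

Lemma is_derive_mul f g x (a b : R) : is_der x f a -> is_der x g b ->
  is_der x (fun y => f y * g y) (a * g x + f x * b).
Proof.
move=> fa gb; have := is_deriveM fa gb.
by move/is_derive_eq; apply; rewrite /GRing.scale /=; lra.
Qed.

Lemma is_derive_scale (k : R) f x (a : R) : is_der x f a ->
  is_der x (fun y => k * f y) (k * a).
Proof.
move=> fa; have := is_derive_mul (is_derive_cst k x 1) fa.
by move/is_derive_eq; apply; rewrite mul0r add0r.
Qed.

Lemma is_derive_inv f x (a : R) : f x != 0 -> is_der x f a ->
  is_der x (fun y => (f y)^-1) (- a * (f x)^-1 ^+ 2).
Proof.
move=> fx fa; have := is_deriveV fx fa.
by move/is_derive_eq; apply; rewrite /GRing.scale /= exprVn; lra.
Qed.

Lemma is_derive_dilation (n : R) x : is_der x (fun y : R => n * y) n.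
Proof.
have := is_derive_scale n (is_derive_id x (1 : R)).
by move/is_derive_eq; apply; lra.
Qed.

Lemma is_derive_derive1 f x (a : R) : is_der x f a -> derive1 f x = a.
Proof. by move=> fa; rewrite derive1E derive_val. Qed.

Lemma is_derive_continuous f g : (forall x, is_der x f (g x)) -> continuous f.
Proof.
move=> fg x; apply: differentiable_continuous.
by apply/derivable1_diffP; have [] := fg x.
Qed.

Lemma mean_value f g : (forall x, is_der x f (g x)) ->
  forall x y, x <= y -> exists2 z, x <= z <= y & f y - f x = g z * (y - x).
Proof.
move=> fg x y xy; have [|z zi E] := @MVT_segment _ f g x y xy (fun z _ => fg z).
- exact/continuous_subspaceT/(is_derive_continuous fg).
- by exists z.
Qed.

Lemma lipschitz f g (M : R) : (forall x, is_der x f (g x)) ->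
  (forall x, `|g x| <= M) -> forall x y, `|f x - f y| <= M * `|x - y|.
Proof.
move=> fg gM x y; wlog xy : x y / y <= x.
  by move=> H; case: (leP y x) => [/H//|/ltW/H]; rewrite distrC (distrC x).
have [z _ ->] := mean_value fg xy.
by rewrite normrM ler_wpM2r.
Qed.

Definition smooth f := forall n x, derivable (derive1n n f) x (1 : R).

Lemma smooth_is_derive f n x : smooth f ->
  is_der x (derive1n n f) (derive1n n.+1 f x).
Proof.
by move=> fs; rewrite derive1nS derive1E; apply/derivableP; exact: fs.
Qed.

Lemma derive_seq (F : nat -> R -> R) :
  (forall n x, is_der x (F n) (F n.+1 x)) ->
  (forall n, derive1n n (F 0%N) = F n) /\ smooth (F 0%N).
Proof.
move=> FF; suff E n : derive1n n (F 0%N) = F n.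
  by split=> // n x; rewrite E; have [] := FF n x.
elim: n => [|n IH]; first by rewrite derive1n0.
by rewrite derive1nS IH; apply/funext => x; exact: is_derive_derive1.
Qed.

Lemma derive_seq_antiderivative f g : (forall x, is_der x f (g x)) ->
  smooth g -> (forall n, derive1n n.+1 f = derive1n n g) /\ smooth f.
Proof.
move=> fg gs; pose F n := if n is m.+1 then derive1n m g else f.
have [n x|E fs] := derive_seq (F := F); first last.
  by split=> // n; exact: (E n.+1).
by case: n => [|n]; [exact: fg|exact: smooth_is_derive].
Qed.

Lemma derive_seq_dilation (c n : R) f : smooth f ->
  (forall k, derive1n k (fun x => c * f (n * x)) =
     fun x => c * n ^+ k * derive1n k f (n * x)) /\
  smooth (fun x => c * f (n * x)).
Proof.
move=> fs; pose F k x := c * n ^+ k * derive1n k f (n * x).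
have F0 : F 0%N = fun x => c * f (n * x).
  by apply/funext => x; rewrite /F expr0 mulr1 derive1n0.
rewrite -F0; apply: derive_seq => k x.
have H := is_derive1_comp (smooth_is_derive k (n * x) fs) (is_derive_dilation n x).
have := is_derive_scale (c * n ^+ k) H.
by move/is_derive_eq; apply; rewrite /F exprS; lra.
Qed.

Lemma derive_seq_affine (t : R) f : smooth f ->
  (forall k x, derive1n k (fun x => x + t + f x) x =
     (if k is 0 then x + t else if k is 1 then 1 else 0) + derive1n k f x) /\
  smooth (fun x => x + t + f x).
Proof.
move=> fs.
pose F k x := (if k is 0 then x + t else if k is 1 then 1 else 0) + derive1n k f x.
have F0 : F 0%N = fun x => x + t + f x by apply/funext => x; rewrite /F derive1n0.
rewrite -F0; suff /derive_seq[E Fs] : forall k x, is_der x (F k) (F k.+1 x).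
  by split=> // k x; rewrite E.
move=> k x; apply: is_derive_add; last exact: smooth_is_derive.
case: k => [|[|k]]; [|exact: is_derive_cst..].
have := is_derive_add (is_derive_id x (1 : R)) (is_derive_cst t x 1).
by move/is_derive_eq; apply; rewrite addr0.
Qed.

(** The Taylor polynomial is differentiated with respect to its base point: the sum telescopes to
    one term, and the mean value theorem concludes. Hence the factorial of [n] and not of
    [n + 1]. *)
Lemma taylor_remainder (F : nat -> R -> R) (M : R) n :
  (forall k x, is_der x (F k) (F k.+1 x)) ->
  (forall x, `|F n.+1 x| <= M) -> forall x y,
  `|F 0%N y - \sum_(k < n.+1) F k x * (y - x) ^+ k / k`!%:R|
    <= M * `|y - x| ^+ n.+1 / n`!%:R.
Proof.
move=> FF FM x y.
pose D m u := \sum_(k < m) F k u * (y - u) ^+ k / k`!%:R.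
have Dd m u : is_der u (D m.+1) (F m.+1 u * (y - u) ^+ m / m`!%:R).
  have dd : is_der u (fun u => y - u) (- 1).
    have := is_derive_add (is_derive_cst y u 1) (is_deriveNid u (1 : R)).
    by move/is_derive_eq; apply; rewrite add0r.
  elim: m => [|m IH].
    have -> : D 1%N = F 0%N.
      apply/funext => v; rewrite /D big_ord_recl big_ord0 /=.
      by rewrite fact0 divr1 mulr1 addr0.
    by have := FF 0%N u; move/is_derive_eq; apply; rewrite expr0 mulr1 divr1.
  have -> : D m.+2 = fun v => D m.+1 v + m.+1`!%:R^-1 * (F m.+1 v * (y - v) ^+ m.+1).
    by apply/funext => v; rewrite /D big_ord_recr /= [X in _ + X]mulrC.
  have dp : is_der u (fun v => (y - v) ^+ m.+1) (- (m.+1%:R * (y - u) ^+ m)).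
    have -> : (fun v => (y - v) ^+ m.+1) = (fun v => y - v) ^+ m.+1.
      by apply/funext => v; rewrite exprfctE.
    have := is_deriveX m.+1 dd; move/is_derive_eq; apply.
    by rewrite /GRing.scale /= mulrN1 mulr_natl.
  have := is_derive_add IH (is_derive_scale m.+1`!%:R^-1 (is_derive_mul (FF m.+1 u) dp)).
  move/is_derive_eq; apply.
  have -> : m`!%:R^-1 = m.+1%:R * m.+1`!%:R^-1 :> R.
    by rewrite factS natrM invfM mulrA divff ?mul1r// pnatr_eq0.
  lra.
have Dy : D n.+1 y = F 0%N y.
  rewrite /D big_ord_recl /= expr0 mulr1 fact0 divr1 big1 ?addr0// => i _.
  by rewrite subrr expr0n /= mulr0 mul0r.
rewrite -/(D n.+1 x) -Dy.
have [z zb ->] : exists2 z, `|y - z| <= `|y - x| &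
    D n.+1 y - D n.+1 x = F n.+1 z * (y - z) ^+ n / n`!%:R * (y - x).
  have [xy|/ltW yx] := leP x y.
    have [z /andP[xz zy] E] := mean_value (Dd n) xy; exists z => //.
    by rewrite !ger0_norm ?subr_ge0// lerD2l lerN2.
  have [z /andP[yz zx] E] := mean_value (Dd n) yx; exists z.
    by rewrite !ler0_norm ?subr_le0// lerN2 lerD2l lerN2.
  by rewrite -opprB E; lra.
rewrite exprSr !normrM normrX normfV (ger0_norm (ler0n _ _)).
rewrite mulrA [leRHS]mulrAC ler_wpM2r// ler_wpM2r ?invr_ge0//.
by apply: ler_pM => //; rewrite lerXn2r ?nnegrE.
Qed.

(** Cauchy-type estimates, uniform in [x]. They start at the first derivative so as to apply to
    lifts, which are unbounded. *)
Definition factorial_growth (C A : R) f := smooth f /\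
  forall n x, `|derive1n n.+1 f x| <= C * A ^+ n * n`!%:R.

Lemma factorial_growth_analytic C A f : factorial_growth C A f -> analytic f.
Proof.
move=> [fs fb] x.
have A0 : 0 < `|A| + 1 by rewrite ltr_pwDr.
exists (fun k => derive1n k f x / k`!%:R), ((`|A| + 1)^-1); split.
  by rewrite invr_gt0.
move=> h hr.
have C0 : 0 <= C by have := fb 0%N x; rewrite expr0 !mulr1; apply: le_trans.
have z1 : `|(`|A| * `|h|)| < 1.
  rewrite normrM !normr_id.
  move: hr; rewrite -div1r ltr_pdivlMr// => hr.
  by apply: le_lt_trans hr; rewrite mulrDr mulr1 mulrC lerDl.
have := cvg_geometric (C * `|h|) z1.
move=> /cvgrPdist_le H; rewrite -cvg_shiftS; apply/cvgrPdist_le => e e0.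
have := H e e0; apply: filterS => n.
rewrite sub0r normrN /geometric /= => ge.
have FF k y : is_der y (derive1n k f) (derive1n k.+1 f y).
  exact: smooth_is_derive.
have := taylor_remainder (n := n) (F := fun k => derive1n k f) FF (M := C * `|A| ^+ n * n`!%:R).
move=> /(_ _ x (x + h)) T.
rewrite /series /= big_mkord.
have E : \sum_(k < n.+1) derive1n k f x / k`!%:R * h ^+ k
    = \sum_(k < n.+1) derive1n k f x * (x + h - x) ^+ k / k`!%:R.
  by apply: eq_bigr => k _; rewrite addrC addKr mulrAC.
rewrite E; apply: (le_trans (T _)).
  move=> y; apply: le_trans (fb n y) _; rewrite ler_wpM2r// ler_wpM2l//.
  by rewrite -normrX ler_norm.
apply: le_trans ge; apply: le_trans (ler_norm _).
rewrite addrC addKr mulrAC mulfK ?pnatr_eq0 -?lt0n ?fact_gt0//.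
by rewrite exprMn exprS; lra.
Qed.

End Calculus.

(** * Derivatives of polynomials in bounded functions *)

Section Growth.
Variable R : realType.
Implicit Types (f g : R -> R) (x y : R).
Local Notation is_der x f l := (is_derive (x : R) (1 : R) (f : R -> R) l).

Lemma factorial_growth_dilation (C A c n : R) f : factorial_growth C A f ->
  factorial_growth (`|c * n| * C) (A * `|n|) (fun x => c * f (n * x)).
Proof.
move=> [fs fb]; have [E gs] := derive_seq_dilation c n fs; split=> // k x.
rewrite E !normrM normrX exprMn exprS.
have -> : `|c| * `|n| * C * (A ^+ k * `|n| ^+ k) * k`!%:R
  = `|c| * (`|n| * `|n| ^+ k) * (C * A ^+ k * k`!%:R) by lra.
by rewrite ler_wpM2l// !mulr_ge0.
Qed.

Lemma factorial_growth_affine (C A t : R) f : 0 <= A -> factorial_growth C A f ->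
  factorial_growth (1 + C) A (fun x => x + t + f x).
Proof.
move=> A0 [fs fb]; have [E gs] := derive_seq_affine t fs; split=> // k x.
rewrite E; apply: (le_trans (ler_normD _ _)).
rewrite !mulrDl mul1r; apply: lerD; last exact: fb.
case: k => [|k]; first by rewrite normr1 mulr1.
by rewrite normr0 mulr_ge0// exprn_ge0.
Qed.

Lemma periodic_derive1n f n x : smooth f -> (forall x, f (x + 1) = f x) ->
  derive1n n f (x + 1) = derive1n n f x.
Proof.
move=> fs; elim: n f fs x => [|n IH] f fs x fp; first by rewrite derive1n0.
have d1 (h : R -> R) : smooth h -> (forall x, h (x + 1) = h x) ->
    forall x, derive1 h (x + 1) = derive1 h x.
  move=> hs hp z; apply/esym/is_derive_derive1.
  have hE : h = h \o (fun y => y + 1) by apply/funext => y /=; rewrite hp.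
  rewrite {1}hE.
  have s1 : is_der z (fun y => y + 1) 1.
    have := is_derive_add (is_derive_id z (1 : R)) (is_derive_cst (1 : R) z 1).
    by move/is_derive_eq; apply; rewrite addr0.
  have := @is_derive1_comp _ _ (fun y => y + 1) _ _ _
    (smooth_is_derive 0 (z + 1) hs) s1.
  by rewrite derive1n0 derive1n1 mulr1.
rewrite !derive1Sn; apply: IH; last exact: d1.
by move=> k z; rewrite -derive1Sn.
Qed.

Lemma periodic_oscillation f g (M : R) : (forall x, is_der x f (g x)) ->
  (forall x, f (x + 1) = f x) -> (forall x, `|g x| <= M) ->
  forall x y, `|f x - f y| <= M.
Proof.
move=> fg fp gM x y.
have M0 : 0 <= M by apply: le_trans (gM 0).
have [x' x'1 <-] := periodic_reduce x fp.
have [y' y'1 <-] := periodic_reduce y fp.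
apply: (le_trans (lipschitz fg gM x' y')).
by rewrite ler_piMr// ler_norml; lra.
Qed.

(** Each derivative of a periodic function vanishes somewhere, by the mean value theorem over one
    period. A bound on a derivative therefore passes to the previous one with the same constant. *)
Lemma periodic_oscillation_derive1n f n (M : R) : smooth f ->
  (forall x, f (x + 1) = f x) ->
  (forall x, `|derive1n n.+1 f x| <= M) -> forall x y, `|f x - f y| <= M.
Proof.
move=> fs fp; elim: n => [|n IH] fM.
  apply: periodic_oscillation fp fM => x.
  by have := smooth_is_derive 0 x fs; rewrite derive1n0.
apply: IH => x.
have [z _ E] := mean_value (fun z => smooth_is_derive n z fs) (@ler01 R).
have gz : derive1n n.+1 f z = 0.
  by move: E; rewrite -[X in derive1n n f X]add0r periodic_derive1n//; lra.
rewrite -[X in `|X|]subr0 -gz.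
apply: (periodic_oscillation (fun u => smooth_is_derive n.+1 u fs) _ fM).
by move=> u; exact: periodic_derive1n.
Qed.

(* [cls A d C f]: [f] is a polynomial of degree at most [d] in the functions
   of [A], with coefficients of total absolute value at most [C]. *)
Inductive cls (A : set (R -> R)) : nat -> R -> (R -> R) -> Prop :=
| cls_cst k : cls A 0 `|k| (fun=> k)
| cls_atom a d C f : A a -> cls A d C f -> cls A d.+1 C (fun x => a x * f x)
| cls_add d C C' f g : cls A d C f -> cls A d C' g ->
    cls A d (C + C') (fun x => f x + g x)
| cls_weak d d' C C' f : (d <= d')%N -> C <= C' -> cls A d C f -> cls A d' C' f.

Section Atoms.
Variables (A : set (R -> R)) (m : nat) (kappa : R).
Hypothesis atom_le1 : forall a, A a -> forall x, `|a x| <= 1.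
Hypothesis atom_derive : forall a, A a -> exists2 b,
  (forall x, is_der x a (b x)) & cls A m.+1 kappa b.
Hypothesis kappa_ge0 : 0 <= kappa.
Local Notation cls := (cls A).

Lemma cls_ge0 d C f : cls d C f -> 0 <= C.
Proof.
elim=> {d C f} [//|//|d C C' f g _ C0 _ C'0|d d' C C' f _ CC' _ C0].
  exact: addr_ge0.
exact: le_trans CC'.
Qed.

Lemma cls_bound d C f : cls d C f -> forall x, `|f x| <= C.
Proof.
elim=> {d C f} [k x //|a d C f Aa _ IH x|d C C' f g _ IH _ IH' x|
  d d' C C' f _ CC' _ IH x].
- by rewrite normrM -[leRHS]mul1r ler_pM// atom_le1.
- by rewrite (le_trans (ler_normD _ _))// lerD.
- exact: le_trans CC'.
Qed.

Lemma cls_scale k d C f : cls d C f -> cls d (`|k| * C) (fun x => k * f x).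
Proof.
elim=> {d C f} [c|a d C f Aa _ IH|d C C' f g _ IH _ IH'|d d' C C' f dd' CC' _ IH].
- by rewrite -normrM; exact: cls_cst.
- have -> : (fun x => k * (a x * f x)) = fun x => a x * (k * f x).
    by apply/funext => x; rewrite mulrCA.
  exact: cls_atom.
- have -> : (fun x => k * (f x + g x)) = fun x => k * f x + k * g x.
    by apply/funext => x; rewrite mulrDr.
  by rewrite mulrDr; exact: cls_add.
- by apply: cls_weak IH => //; rewrite ler_wpM2l.
Qed.

Lemma cls_mul d d' C C' f g : cls d C f -> cls d' C' g ->
  cls (d + d') (C * C') (fun x => f x * g x).
Proof.
move=> fc gc; have C'0 := cls_ge0 gc.
elim: fc => {d C f} [k|a d C f Aa _ IH|d C1 C2 f1 f2 _ IH1 _ IH2|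
  d e C1 C2 f de C12 _ IH].
- by rewrite add0n; exact: cls_scale.
- have -> : (fun x => a x * f x * g x) = fun x => a x * (f x * g x).
    by apply/funext => x; rewrite mulrA.
  exact: cls_atom.
- have -> : (fun x => (f1 x + f2 x) * g x) = fun x => f1 x * g x + f2 x * g x.
    by apply/funext => x; rewrite mulrDl.
  by rewrite mulrDl; exact: cls_add.
- by apply: cls_weak IH; rewrite ?leq_add2r// ler_wpM2r.
Qed.

Lemma cls_derive d C f : cls d C f -> exists2 g,
  (forall x, is_der x f (g x)) & cls (d + m) (kappa * d%:R * C) g.
Proof.
elim=> {d C f} [k|a d C f Aa fc [g fg gc]|d C C' f1 f2 _ [g1 fg1 gc1] _ [g2 fg2 gc2]|
  d d' C C' f dd' CC' fc [g fg gc]].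
- exists (fun=> 0); first by move=> x; exact: is_derive_cst.
  by apply: (cls_weak _ _ (cls_cst A 0)); rewrite // normr0 mulr0 mul0r.
- have [b ab bc] := atom_derive Aa.
  exists (fun x => b x * f x + a x * g x) => [x|]; first exact: is_derive_mul.
  have -> : kappa * d.+1%:R * C = kappa * C + kappa * d%:R * C.
    by rewrite -natr1; lra.
  apply: cls_add; last by rewrite addSn; exact: cls_atom.
  by rewrite addSnnS addnC; exact: cls_mul.
- exists (fun x => g1 x + g2 x) => [x|]; first exact: is_derive_add.
  by rewrite mulrDr; exact: cls_add.
- exists g => //; apply: cls_weak gc; first by rewrite leq_add2r.
  have C0 := cls_ge0 fc.
  by rewrite ler_pM ?mulr_ge0// ler_wpM2l// ler_nat.
Qed.

(** One derivation adds [m] to the degree and costs [kappa] times the degree. The degree [d + i m]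
    at step [i] is at most [(d + m) (i + 1)], so the product of the costs is a power times a
    factorial. *)
Lemma cls_derive1n d C f n : cls d C f ->
  cls (d + n * m) (C * (kappa * (d + m)%:R) ^+ n * n`!%:R) (derive1n n f) /\
  forall x, is_der x (derive1n n f) (derive1n n.+1 f x).
Proof.
move=> fc.
have step : cls (d + n * m) (C * (kappa * (d + m)%:R) ^+ n * n`!%:R) (derive1n n f).
  elim: n => [|n IH]; first by rewrite derive1n0 addn0 expr0 !mulr1.
  have [g fg gc] := cls_derive IH.
  have -> : derive1n n.+1 f = g.
    by rewrite derive1nS; apply/funext => x; exact: is_derive_derive1.
  apply: cls_weak gc; first by rewrite mulSn addnA addnAC.
  rewrite factS exprS !natrM.
  have -> : C * (kappa * (d + m)%:R * (kappa * (d + m)%:R) ^+ n) * (n.+1%:R * n`!%:R)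
    = kappa * ((d + m)%:R * n.+1%:R) * (C * (kappa * (d + m)%:R) ^+ n * n`!%:R) by lra.
  rewrite ler_wpM2r ?ler_wpM2l//.
    by rewrite !mulr_ge0 ?exprn_ge0 ?mulr_ge0// (cls_ge0 fc).
  by rewrite -natrM ler_nat mulnS leq_add ?leq_addr// mulnDl [leqRHS]addnC mulnC leq_addr.
split=> [|x]; [exact: step|have [g fg gc] := cls_derive step].
by rewrite derive1nS (is_derive_derive1 (fg x)).
Qed.

Lemma cls_growth d C f g : (forall x, is_der x f (g x)) -> cls d C g ->
  factorial_growth C (kappa * (d + m)%:R) f.
Proof.
move=> fg gc.
have gs : smooth g.
  by move=> n x; have [_ /(_ x)[]] := cls_derive1n n gc.
have [E fs] := derive_seq_antiderivative fg gs; split=> // n x.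
by rewrite E; have [c _] := cls_derive1n n gc; exact: cls_bound c x.
Qed.

End Atoms.
End Growth.

(** * The Blaschke perturbation *)

Section Perturbation.
Variable R : realType.
Implicit Types (f g : R -> R) (x y z : R).
Local Notation is_der x f l := (is_derive (x : R) (1 : R) (f : R -> R) l).

Lemma pi_lt4 : pi < 4 :> R.
Proof. by have := pihalf_lt2 R; lra. Qed.

Definition csin y : R := sin (2 * pi * y).
Definition ccos y : R := cos (2 * pi * y).

Lemma csin_le1 y : `|csin y| <= 1.
Proof. by rewrite ler_norml sin_geN1 sin_le1. Qed.

Lemma ccos_le1 y : `|ccos y| <= 1.
Proof. by rewrite ler_norml cos_geN1 cos_le1. Qed.

Lemma ccos2Dcsin2 y : ccos y ^+ 2 + csin y ^+ 2 = 1.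
Proof. exact: cos2Dsin2. Qed.

Lemma csin1 y : csin (y + 1) = csin y.
Proof. by rewrite /csin mulrDr mulr1 mulr_natl sinD2pi. Qed.

Lemma ccos1 y : ccos (y + 1) = ccos y.
Proof. by rewrite /ccos mulrDr mulr1 mulr_natl cosD2pi. Qed.

Lemma csinN y : csin (- y) = - csin y.
Proof. by rewrite /csin mulrN sinN. Qed.

Lemma ccosN y : ccos (- y) = ccos y.
Proof. by rewrite /ccos mulrN cosN. Qed.

Lemma csin_half y : csin (y + 2^-1) = - csin y.
Proof.
have E : 2 * pi * (y + 2^-1) = 2 * pi * y + pi :> R by lra.
by rewrite /csin E sinDpi.
Qed.

Lemma ccos_half y : ccos (y + 2^-1) = - ccos y.
Proof.
have E : 2 * pi * (y + 2^-1) = 2 * pi * y + pi :> R by lra.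
by rewrite /ccos E cosDpi.
Qed.

Lemma is_derive_csin y : is_der y csin (2 * pi * ccos y).
Proof.
have := is_derive1_comp (is_derive_sin (2 * pi * y)) (is_derive_dilation (2 * pi) y).
by move/is_derive_eq; apply; rewrite mulrC.
Qed.

Lemma is_derive_ccos y : is_der y ccos (- (2 * pi * csin y)).
Proof.
have := is_derive1_comp (is_derive_cos (2 * pi * y)) (is_derive_dilation (2 * pi) y).
by move/is_derive_eq; apply; rewrite mulNr mulrC.
Qed.

Variable b : R.
Hypotheses (b_gt0 : 0 < b) (b_small : b <= 1000^-1).

(** With [z = exp(2 pi i y)] the arctangent is the argument of [w = 1 - b / z], whose real part is
    positive. Thus [exp(2 pi i psi)] is the conjugate of [w] divided by [w], and [kern] is the
    inverse of [|w|^2]. *)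
Definition psi y := - (pi^-1 * atan (b * csin y / (1 - b * ccos y))).
Definition kern y : R := (1 - 2 * b * ccos y + b ^+ 2)^-1.
Definition dpsi y := 2 * b * (b - ccos y) * kern y.

Lemma denom_bounds y : 2^-1 <= 1 - b * ccos y <= 2.
Proof.
have := ccos_le1 y; rewrite ler_norml => /andP[c1 c2].
have H1 : b * ccos y <= b * 1 by rewrite ler_wpM2l// ltW.
have H2 : b * (-1) <= b * ccos y by rewrite ler_wpM2l// ltW.
by move: b_small; lra.
Qed.

Lemma kern_denom_ge y : 2^-1 <= 1 - 2 * b * ccos y + b ^+ 2.
Proof.
have := ccos_le1 y; rewrite ler_norml => /andP[c1 c2].
have H1 : b * ccos y <= b * 1 by rewrite ler_wpM2l// ltW.
have : 0 <= b ^+ 2 by exact: sqr_ge0.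
by move: b_small; lra.
Qed.

Lemma kern_bounds y : 0 <= kern y <= 2.
Proof.
have H := kern_denom_ge y; rewrite invr_ge0 (le_trans _ H)//=.
by rewrite -[leRHS]invrK lef_pV2 ?posrE ?(lt_le_trans _ H).
Qed.

Lemma is_derive_psi y : is_der y psi (dpsi y).
Proof.
have /andP[D0 _] := denom_bounds y.
have Dn0 : 1 - b * ccos y != 0 by rewrite gt_eqF// (lt_le_trans _ D0).
have K0 := kern_denom_ge y.
have Kn0 : 1 - 2 * b * ccos y + b ^+ 2 != 0 by rewrite gt_eqF// (lt_le_trans _ K0).
have dd : is_der y (fun y => 1 - b * ccos y) (2 * pi * b * csin y).
  have := is_derive_add (is_derive_cst (1 : R) y 1)
    (is_derive_scale (- b) (is_derive_ccos y)).
  move=> H; have E : (fun y => 1 - b * ccos y) = fun y => 1 + - b * ccos y.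
    by apply/funext => z; rewrite mulNr.
  by rewrite E; move: H => /is_derive_eq; apply; lra.
have dX := is_derive_mul (is_derive_scale b (is_derive_csin y))
  (is_derive_inv (f := fun y => 1 - b * ccos y) Dn0 dd).
have da := @is_derive1_comp _ _ (fun z => b * csin z / (1 - b * ccos z)) _ _ _
  (is_derive1_atan _) dX.
have := is_derive_scale (- pi^-1) da.
have -> : (fun y0 => - pi^-1 * (atan \o (fun y1 => b * csin y1 * (1 - b * ccos y1)^-1)) y0) = psi.
  by apply/funext => z; rewrite /psi /= mulNr.
move/is_derive_eq; apply.
have cs := ccos2Dcsin2 y; set s := csin y in cs dX da *.
set c := ccos y in cs D0 Dn0 K0 Kn0 dX da *.
rewrite /dpsi /kern -/c.
have p0 : pi != 0 :> R by rewrite gt_eqF// pi_gt0.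
set D := 1 - b * c in D0 Dn0 *; set K := 1 - 2 * b * c + b ^+ 2 in K0 Kn0 *.
(* Both sides are [|w|^2 / D^2], where [D] and [b s] are the real and imaginary parts of
   [w = 1 - b / z]. *)
have E1 : 1 + (b * s / D) ^+ 2 = K / D ^+ 2.
  apply: (mulIf (expf_neq0 2 Dn0)); rewrite mulrDl -exprMn mulfVK// mulfVK ?expf_neq0//.
  have s2 : s ^+ 2 = 1 - c ^+ 2 by lra.
  by rewrite exprMn s2 /K /D; lra.
rewrite E1 invfM invrK.
have E2 : b * (2 * pi * c) / D + b * s * (- (2 * pi * b * s) * D^-1 ^+ 2)
   = 2 * pi * b * (c - b) / D ^+ 2.
  apply: (mulIf (expf_neq0 2 Dn0)); rewrite mulfVK ?expf_neq0// mulrDl.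
  rewrite [X in X * D ^+ 2]mulrC.
  have -> : D^-1 * (b * (2 * pi * c)) * D ^+ 2 = b * (2 * pi * c) * D.
    by rewrite expr2 -[RHS](mulVKf Dn0); lra.
  have -> : b * s * (- (2 * pi * b * s) * D^-1 ^+ 2) * D ^+ 2 = - (2 * pi * b ^+ 2 * s ^+ 2).
    have : D^-1 ^+ 2 * D ^+ 2 = 1 by rewrite -exprMn mulVf// expr1n.
    set e := D^-1 ^+ 2; set d := D ^+ 2 => ed.
    have -> : b * s * (- (2 * pi * b * s) * e) * d = - (2 * pi * b ^+ 2 * s ^+ 2) * (e * d) by lra.
    by rewrite ed mulr1.
  have -> : s ^+ 2 = 1 - c ^+ 2 by lra.
  by rewrite /D; lra.
rewrite E2.
have : D ^+ 2 / D ^+ 2 = 1 by rewrite divff ?expf_neq0.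
set e := (D ^+ 2)^-1; set d := D ^+ 2 => ed.
have pp : pi^-1 * pi = 1 :> R by rewrite mulVf.
have -> : - pi^-1 * (K^-1 * d * (2 * pi * b * (c - b) * e))
   = - (pi^-1 * pi) * (d * e) * (2 * b * (c - b) * K^-1) by lra.
by rewrite pp ed; lra.
Qed.

Lemma psi1 y : psi (y + 1) = psi y.
Proof. by rewrite /psi csin1 ccos1. Qed.

Lemma psiN y : psi (- y) = - psi y.
Proof. by rewrite /psi csinN ccosN mulrN mulNr atanN mulrN. Qed.

Lemma psi0 : psi 0 = 0.
Proof. by have := psiN 0; rewrite oppr0; lra. Qed.

Lemma dpsi_le y : `|dpsi y| <= 5 * b.
Proof.
have := ccos_le1 y; rewrite ler_norml => c1.
have /andP[k0 k2] := kern_bounds y.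
rewrite /dpsi !normrM (ger0_norm k0) (gtr0_norm b_gt0) ger0_norm//.
have : `|b - ccos y| <= 1001 / 1000 by rewrite ler_norml; move: b_gt0 b_small c1; lra.
move=> H; apply: (@le_trans _ _ (2 * b * (1001 / 1000) * 2)); last by move: b_gt0; lra.
by rewrite !ler_pM// ?mulr_ge0// ?ltW.
Qed.

Lemma psi_lipschitz x y : `|psi x - psi y| <= 5 * b * `|x - y|.
Proof. exact: lipschitz is_derive_psi dpsi_le x y. Qed.

Lemma psi_le y : `|psi y| <= 5 * b.
Proof.
rewrite -[psi y]subr0 -psi0.
exact: periodic_oscillation is_derive_psi psi1 dpsi_le y 0.
Qed.

(* Along a base function [k] with derivative [2 * W], these functions generate
   an algebra closed under derivation as soon as it contains [W']. *)
Definition atoms (k W : R -> R) : set (R -> R) :=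
  [set a | [\/ a = csin \o k, a = ccos \o k, a = (fun y => kern (k y) / 2) | a = W]].

(* The rate [kappa * (d + m)] of [cls_growth] for degree [d = 3] and atoms whose
   derivatives have degree [m + 1 = 9] and size [kappa = 1000]. *)
Definition growth_rate : R := 1000 * (3 + 8)%:R.

Section Atoms.
Variables (k W Wd : R -> R).
Hypothesis k_der : forall y, is_der y k (2 * W y).
Hypothesis W_le1 : forall y, `|W y| <= 1.
Hypothesis W_der : forall y, is_der y W (Wd y).
Hypothesis Wd_cls : cls (atoms k W) 9 1000 Wd.
Let A := atoms k W.
Let S := csin \o k.
Let C := ccos \o k.
Let U y := kern (k y) / 2.

Lemma cls_of_atom (B : set (R -> R)) a : B a -> cls B 1 1 a.
Proof.
move=> Ba; have := cls_atom Ba (cls_cst B 1); rewrite normr1.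
by have -> : (fun x => a x * 1) = a by apply/funext => x; rewrite mulr1.
Qed.

Lemma cls_S : cls A 1 1 S. Proof. by apply: cls_of_atom; apply: Or41. Qed.
Lemma cls_C : cls A 1 1 C. Proof. by apply: cls_of_atom; apply: Or42. Qed.
Lemma cls_U : cls A 1 1 U. Proof. by apply: cls_of_atom; apply: Or43. Qed.
Lemma cls_W : cls A 1 1 W. Proof. by apply: cls_of_atom; apply: Or44. Qed.

Lemma atoms_le1 a : A a -> forall y, `|a y| <= 1.
Proof.
case=> -> y; [exact: csin_le1|exact: ccos_le1| |exact: W_le1].
have := kern_bounds (k y); rewrite ler_norml; lra.
Qed.

Lemma U_der y : is_der y U (- (16 * pi * b) * (S y * (U y * (U y * W y)))).
Proof.
have H := kern_denom_ge (k y).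
have Kn0 : 1 - 2 * b * ccos (k y) + b ^+ 2 != 0 by rewrite gt_eqF// (lt_le_trans _ H).
have dC := is_derive1_comp (is_derive_ccos (k y)) (k_der y).
have dK : is_der y (fun z => 1 - 2 * b * ccos (k z) + b ^+ 2)
    (8 * pi * b * (S y * W y)).
  have := is_derive_add (is_derive_cst (1 + b ^+ 2) y 1) (is_derive_scale (- (2 * b)) dC).
  have -> : (fun z => cst (1 + b ^+ 2) z + - (2 * b) * (ccos \o k) z)
     = fun z => 1 - 2 * b * ccos (k z) + b ^+ 2.
    by apply/funext => z /=; lra.
  by move/is_derive_eq; apply; rewrite /S /=; lra.
have := is_derive_scale 2^-1 
  (is_derive_inv (f := fun z => 1 - 2 * b * ccos (k z) + b ^+ 2) Kn0 dK).
have -> : (fun z => 2^-1 * (1 - 2 * b * ccos (k z) + b ^+ 2)^-1) = U.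
  by apply/funext => z; rewrite /U /kern mulrC.
by move/is_derive_eq; apply; rewrite /U /kern; lra.
Qed.

Lemma atoms_derive a : A a -> exists2 d, (forall y, is_der y a (d y)) & cls A 9 1000 d.
Proof.
have pi4 := pi_lt4; have pi0 := pi_gt0 R.
case=> ->.
- exists (fun y => 4 * pi * (C y * W y)).
    move=> y; have := is_derive1_comp (is_derive_csin (k y)) (k_der y).
    by move/is_derive_eq; apply; rewrite /C /=; lra.
  apply: cls_weak (cls_scale (4 * pi) (cls_mul cls_C cls_W)) => //.
  by rewrite ger0_norm; lra.
- exists (fun y => - (4 * pi) * (S y * W y)).
    move=> y; have := is_derive1_comp (is_derive_ccos (k y)) (k_der y).
    by move/is_derive_eq; apply; rewrite /S /=; lra.
  apply: cls_weak (cls_scale (- (4 * pi)) (cls_mul cls_S cls_W)) => //.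
  by rewrite normrN ger0_norm; lra.
- exists (fun y => - (16 * pi * b) * (S y * (U y * (U y * W y)))) => [y|].
    exact: U_der.
  apply: cls_weak (cls_scale _ (cls_mul cls_S (cls_mul cls_U (cls_mul cls_U cls_W)))) => //.
  have pb : pi * b <= 4 * 1 by apply: ler_pM; move: b_gt0 b_small; lra.
  by rewrite normrN ger0_norm; [lra|rewrite !mulr_ge0// ltW].
- by exists Wd.
Qed.

(** The derivative has degree 3 in the atoms and size [8 b (b + 1)]. The outcome is a constant
    proportional to [b] with a rate independent of [b], as the norm estimates require. *)
Lemma psi_comp_growth : factorial_growth (10 * b) growth_rate (psi \o k).
Proof.
have dd y : is_der y (psi \o k) (8 * b * ((b - C y) * (U y * W y))).
  have := is_derive1_comp (is_derive_psi (k y)) (k_der y).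
  by move/is_derive_eq; apply; rewrite /dpsi /C /U /=; lra.
have cl : cls A 3 (10 * b) (fun y => 8 * b * ((b - C y) * (U y * W y))).
  have bC : cls A 1 (b + 1) (fun y => b - C y).
    have c1 : cls A 1 b (fun=> b).
      by apply: cls_weak (cls_cst A b) => //; rewrite gtr0_norm.
    have c2 : cls A 1 1 (fun y => - C y).
      have := cls_scale (- 1) cls_C; rewrite normrN1 mulr1.
      by under eq_fun do rewrite mulN1r.
    exact: cls_add c1 c2.
  apply: cls_weak (cls_scale (8 * b) (cls_mul bC (cls_mul cls_U cls_W))) => //.
  rewrite ger0_norm; last by move: b_gt0; lra.
  have bb : b * b <= b * 1000^-1 by rewrite ler_wpM2l// ltW.
  by move: b_gt0; lra.
exact: (cls_growth (m := 8) atoms_le1 atoms_derive (ler0n _ 1000) dd cl).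
Qed.

End Atoms.
End Perturbation.

(** * The circle map, its inverse and the model family *)

Section Model.
Variables (R : realType) (b : R).
Hypotheses (b_gt0 : 0 < b) (b_small : b <= 1000^-1).
Implicit Types (f g : R -> R) (x y z t tau : R).
Local Notation is_der x f l := (is_derive (x : R) (1 : R) (f : R -> R) l).
Local Notation psi := (psi b).
Local Notation dpsi := (dpsi b).

Lemma psi_growth : factorial_growth (10 * b) (growth_rate R) psi.
Proof.
apply: (@psi_comp_growth _ b b_gt0 b_small id (fun=> 2^-1) (fun=> 0)) => [y|y|].
- by have := is_derive_id y (1 : R); move/is_derive_eq; apply; rewrite mulfV ?pnatr_eq0.
- by rewrite ger0_norm ?invr_ge0// invf_le1// ler1n.
- by apply: (cls_weak (leq0n _) _ (cls_cst _ 0)); rewrite normr0 ler0n.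
Qed.

Lemma growth_rate_ge0 : 0 <= growth_rate R.
Proof. by rewrite /growth_rate mulr_ge0 ?ler0n. Qed.

Definition circle_map y := y + psi y.

Lemma dpsi_small y : `|dpsi y| <= 2^-1.
Proof.
by apply: le_trans (dpsi_le b_gt0 b_small y) _; move: b_small; lra.
Qed.

Lemma psi_contract x y : `|psi x - psi y| <= 2^-1 * `|x - y|.
Proof.
apply: le_trans (psi_lipschitz b_gt0 b_small x y) _; rewrite ler_wpM2r//.
by move: b_small; lra.
Qed.

Lemma psi_incr x y : x < y -> x + psi x < y + psi y.
Proof.
move=> xy; have := psi_contract y x; rewrite (gtr0_norm (x := y - x)) ?subr_gt0//.
by rewrite ler_norml; lra.
Qed.

Lemma psi_continuous : continuous psi.
Proof. exact: (is_derive_continuous (is_derive_psi b_gt0 b_small)). Qed.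

Lemma circle_map_lift : lift circle_map.
Proof.
split=> [x|x y|x]; [|exact: psi_incr|by rewrite /circle_map psi1 addrAC].
by apply: cvgD; [exact: cvg_id|exact: psi_continuous].
Qed.

(** The inverse of [y + psi y + tau]. *)
Definition circle_inv tau y := inverse circle_map (y - tau).

Lemma circle_invE tau y : circle_inv tau y = y - tau - psi (circle_inv tau y).
Proof.
have := inverseK (y - tau) circle_map_lift.
by rewrite -/(circle_inv _ _) {1}/circle_map; lra.
Qed.

Lemma circle_inv1 tau y : circle_inv tau (y + 1) = circle_inv tau y + 1.
Proof.
have [_ _ <-] := inverse_lift circle_map_lift.
by rewrite /circle_inv addrAC.
Qed.

Let W tau y := 2^-1 * (1 + dpsi (circle_inv tau y))^-1.

Let dpsi1_ge y : 2^-1 <= 1 + dpsi y.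
Proof. by have := dpsi_small y; rewrite ler_norml; lra. Qed.

Let dpsi1_neq0 y : 1 + dpsi y != 0.
Proof. by rewrite gt_eqF// (lt_le_trans _ (dpsi1_ge y)). Qed.

Lemma is_derive_circle_inv tau y : is_der y (circle_inv tau) (2 * W tau y).
Proof.
have E : circle_map (circle_inv tau y) = y - tau.
  exact: inverseK circle_map_lift.
have K z : is_der (circle_map z) (inverse circle_map) (1 + dpsi z)^-1.
  have h1 : {near z, cancel circle_map (inverse circle_map)}.
    by apply: filterE => u; exact: (inverseV _ circle_map_lift).
  have h2 : \forall u \near z, continuous_at u circle_map.
    by apply: filterE => u; have [c _ _] := circle_map_lift; exact: c.
  have h3 := is_derive_add (is_derive_id z (1 : R)) (is_derive_psi b_gt0 b_small z).
  exact: (is_derive_inverse h1 h2 h3 (dpsi1_neq0 z)).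
have {}K := K (circle_inv tau y); rewrite E in K.
have s : is_der y (fun y => y - tau) 1.
  have := is_derive_add (is_derive_id y (1 : R)) (is_derive_cst (- tau) y 1).
  by move/is_derive_eq; apply; rewrite addr0.
have := @is_derive1_comp _ _ (fun y => y - tau) _ _ _ K s.
by move/is_derive_eq; apply; rewrite mulr1 /W mulrA mulfV ?pnatr_eq0// mul1r.
Qed.

Let S tau := @csin R \o circle_inv tau.
Let C tau := @ccos R \o circle_inv tau.
Let U tau y := kern b (circle_inv tau y) / 2.

(** The derivative of the inverse map is [2 W] with [W = 1 / (2 (1 + dpsi))] taken along it, so
    [W' = - 2 D W^2], where [D] is the derivative of [dpsi] along the inverse and is a polynomial in
    the atoms. Adding [W] to the atoms thus closes the algebra under derivation. *)
Lemma psi_circle_inv_growth tau :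
  factorial_growth (10 * b) (growth_rate R) (psi \o circle_inv tau).
Proof.
have pi4 := pi_lt4 R; have pi0 := pi_gt0 R.
pose k := circle_inv tau.
have W1 y : `|W tau y| <= 1.
  rewrite /W normrM normfV (ger0_norm (ler0n _ 2)) ler_pdivrMl// mulr1 normfV.
  rewrite ger0_norm; last exact: le_trans (dpsi1_ge _).
  by rewrite -[leRHS]invrK lef_pV2 ?posrE ?(lt_le_trans _ (dpsi1_ge _)).
pose D y := 4 * b * (4 * pi * (S tau y * (W tau y * U tau y)) +
  (b - C tau y) * (- (16 * pi * b) * (S tau y * (U tau y * (U tau y * W tau y))))).
have Cd y : is_der y (C tau) (- (4 * pi) * (S tau y * W tau y)).
  have := is_derive1_comp (is_derive_ccos (k y)) (is_derive_circle_inv tau y).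
  by move/is_derive_eq; apply; rewrite /S /=; lra.
have Dd y : is_der y (fun y => dpsi (k y)) (D y).
  have -> : (fun y => dpsi (k y)) = fun y => 4 * b * ((b + - 1 * C tau y) * U tau y).
    apply/funext => z; rewrite -[dpsi _]/(2 * b * (b - ccos (k z)) * kern b (k z)).
    by rewrite /C /U /k /=; lra.
  have bC := is_derive_add (is_derive_cst b y 1) (is_derive_scale (- 1) (Cd y)).
  have := is_derive_scale (4 * b) (@is_derive_mul _ (fun y => b + - 1 * C tau y) _ _ _ _
     bC (U_der b_gt0 b_small (is_derive_circle_inv tau) y)).
  by move/is_derive_eq; apply; rewrite /D /S /C /U /k /=; lra.
pose Wd y := - 2 * (D y * (W tau y * W tau y)).
apply: (@psi_comp_growth _ b b_gt0 b_small k (W tau) Wd _ W1) => [|y|].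
- exact: is_derive_circle_inv.
- have dd := is_derive_add (is_derive_cst (1 : R) y 1) (Dd y).
  have := is_derive_scale 2^-1
    (is_derive_inv (f := fun y => 1 + dpsi (k y)) (dpsi1_neq0 (k y)) dd).
  by move/is_derive_eq; apply; rewrite /Wd /W; lra.
pose A := atoms b k (W tau).
have cS : cls A 1 1 (S tau) by exact: cls_S.
have cC : cls A 1 1 (C tau) by exact: cls_C.
have cU : cls A 1 1 (U tau) by exact: cls_U.
have cW : cls A 1 1 (W tau) by exact: cls_W.
have bC : cls A 1 (b + 1) (fun y => b - C tau y).
  have c1 : cls A 1 b (fun=> b).
    by apply: cls_weak (cls_cst A b) => //; rewrite gtr0_norm.
  have c2 : cls A 1 1 (fun y => - C tau y).
    have := cls_scale (- 1) cC; rewrite normrN1 mulr1.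
    by under eq_fun do rewrite mulN1r.
  exact: cls_add c1 c2.
have c1 := cls_scale (4 * pi) (cls_mul cS (cls_mul cW cU)).
have c2 := cls_mul bC (cls_scale (- (16 * pi * b))
  (cls_mul cS (cls_mul cU (cls_mul cU cW)))).
have c3 := cls_scale (4 * b) (cls_add (cls_weak (isT : (1 + (1 + 1) <= 5)%N) (lexx _) c1) c2).
apply: cls_weak (cls_scale (- 2) (cls_mul c3 (cls_mul cW cW))) => //.
rewrite !normrN (ger0_norm (_ : 0 <= 16 * pi * b)) ?mulr_ge0 ?ltW//.
rewrite (ger0_norm (_ : 0 <= 4 * pi)) ?mulr_ge0 ?ltW//.
rewrite (ger0_norm (_ : 0 <= 4 * b)) ?mulr_ge0 ?ltW//.
rewrite (ger0_norm (ler0n _ 2)).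
have pb : pi * b <= 4 * 1 by apply: ler_pM; move: b_gt0 b_small; lra.
have b1 : b <= 2^-1 by move: b_small; lra.
have pb0 : 0 <= pi * b by rewrite mulr_ge0 ?ltW.
have pbb : b * (pi * b) <= 2^-1 * (pi * b) by rewrite ler_wpM2r.
have pbbb : b * (b * (pi * b)) <= 2^-1 * (b * (pi * b)).
  by rewrite ler_wpM2r// mulr_ge0// ltW.
lra.
Qed.

(** For [g(y) = y + psi y + tau] this is [g + g^-1 - 2 id], in which [tau] cancels; it is the
    function [V] of the overview. *)
Definition displacement tau y := psi y - psi (circle_inv tau y).

Lemma displacement1 tau y : displacement tau (y + 1) = displacement tau y.
Proof. by rewrite /displacement circle_inv1 !psi1. Qed.

Lemma displacement_le tau y : `|displacement tau y| <= 10 * b.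
Proof.
apply: (le_trans (ler_normB _ _)).
have := psi_le b_gt0 b_small y.
have := psi_le b_gt0 b_small (circle_inv tau y); lra.
Qed.

Lemma factorial_growth_sub (C1 C2 A : R) f g :
  factorial_growth C1 A f -> factorial_growth C2 A g ->
  factorial_growth (C1 + C2) A (fun x => f x - g x).
Proof.
move=> [fs fb] [gs gb].
pose F n x := derive1n n f x + - 1 * derive1n n g x.
have F0 : F 0%N = fun x => f x - g x.
  by apply/funext => x; rewrite /F !derive1n0 mulN1r.
have FF n x : is_der x (F n) (F n.+1 x).
  apply: is_derive_add; first exact: smooth_is_derive.
  by apply: is_derive_scale; exact: smooth_is_derive.
have [E Fs] := derive_seq FF; rewrite -F0; split=> // n x.
rewrite E /F mulN1r; apply: (le_trans (ler_normB _ _)).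
by rewrite !mulrDl lerD.
Qed.

Lemma displacement_growth tau : factorial_growth (20 * b) (growth_rate R) (displacement tau).
Proof.
have -> : 20 * b = 10 * b + 10 * b by lra.
exact: factorial_growth_sub psi_growth (psi_circle_inv_growth tau).
Qed.

Variable N : nat.
Hypothesis N_gt0 : (0 < N)%N.
Let N0 : 0 < N%:R :> R. Proof. by rewrite ltr0n. Qed.
Let Nn0 : N%:R != 0 :> R. Proof. by rewrite gt_eqF. Qed.

Definition wave x : R := N%:R^-1 * psi (N%:R * x).

Lemma wave_growth : factorial_growth (`|N%:R^-1 * N%:R| * (10 * b)) (growth_rate R * `|N%:R|) wave.
Proof. exact: factorial_growth_dilation psi_growth. Qed.

Lemma periodic_dilation (F : R -> R) x :
  (forall y, F (y + 1) = F y) -> F (N%:R * (x + 1)) = F (N%:R * x).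
Proof.
move=> F1; rewrite mulrDr mulr1; elim: {2}N => [|n IH]; first by rewrite addr0.
by rewrite -natr1 addrA F1.
Qed.

Lemma wave1 x : wave (x + 1) = wave x.
Proof. by rewrite /wave periodic_dilation//; exact: psi1. Qed.

Lemma wave_le x : `|wave x| <= N%:R^-1 * (5 * b).
Proof.
rewrite /wave normrM normfV (ger0_norm (ler0n _ _)) ler_wpM2l ?invr_ge0//.
exact: (psi_le b_gt0 b_small).
Qed.

Lemma wave_le1 x : `|wave x| <= 1.
Proof.
apply: le_trans (wave_le x) _; rewrite ler_pdivrMl// mulr1.
by apply: (@le_trans _ _ 1); rewrite ?ler1n//; move: b_small; lra.
Qed.

Lemma wave_continuous : continuous wave.
Proof.
have [ws _] := wave_growth.
by apply: (is_derive_continuous (g := derive1n 1 wave)) => x; exact: (smooth_is_derive 0).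
Qed.

Lemma wave_incr x y : x < y -> x + wave x < y + wave y.
Proof.
move=> xy; rewrite -(ltr_pM2l N0) !mulrDr /wave !mulVKf//.
by apply: psi_incr; rewrite ltr_pM2l.
Qed.

Definition model t := fam wave t.

Lemma model_lift t : lift (model t).
Proof. exact: fam_lift wave_continuous wave1 wave_incr t. Qed.

Lemma modelE t x : N%:R * model t x = circle_map (N%:R * x) + N%:R * t.
Proof. by rewrite /model /fam !mulrDr /wave mulVKf// /circle_map addrAC. Qed.

Lemma inverse_modelE t x :
  inverse (model t) x = N%:R^-1 * circle_inv (N%:R * t) (N%:R * x).
Proof.
apply: (lift_inj (model_lift t)); rewrite inverseK; last exact: model_lift.
apply: (mulfI Nn0); rewrite modelE mulVKf// /circle_inv inverseK ?subrK//.
exact: circle_map_lift.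
Qed.

Lemma model_analytic t : analytic (model t).
Proof.
apply: factorial_growth_analytic.
apply: (@factorial_growth_affine _ _ (growth_rate R * `|N%:R|) t wave _ wave_growth).
exact: (mulr_ge0 growth_rate_ge0 (normr_ge0 N%:R)).
Qed.

Lemma inverse_model_analytic t : analytic (inverse (model t)).
Proof.
have -> : inverse (model t) = fun x => x + (- t) +
    (- N%:R^-1) * (psi \o circle_inv (N%:R * t)) (N%:R * x).
  apply/funext => x; rewrite inverse_modelE circle_invE /= !mulrBr !mulKf//.
  by rewrite mulNr.
apply: factorial_growth_analytic; apply: factorial_growth_affine.
  exact: (mulr_ge0 growth_rate_ge0 (normr_ge0 N%:R)).
exact: factorial_growth_dilation (psi_circle_inv_growth _).
Qed.

Lemma Phi_modelE t x :
  Phi (model t) x = (2 * N%:R)^-1 * displacement (N%:R * t) (N%:R * x).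
Proof.
rewrite /Phi inverse_modelE circle_invE /displacement /model /fam /wave.
rewrite !mulrBr !mulKf// invfM; lra.
Qed.

(** The mean slopes are values of the derivative at two points, so they differ by at most the
    Lipschitz constant [L0] of [wave'] times [z - x]. They are at least 1/2, whence [2 * L0]. *)
Lemma model_distortion : exists2 L : R, 0 <= L &
  forall t x y z, x < y -> y < z ->
  (model t y - model t x) * (z - y)
    <= (1 + L * (z - x)) * ((model t z - model t y) * (y - x)).
Proof.
have [ws wb] := wave_growth.
pose L0 := `|N%:R^-1 * N%:R| * (10 * b) * (growth_rate R * `|N%:R|) ^+ 1 * 1`!%:R : R.
have L00 : 0 <= L0 by apply: le_trans (wb 1%N 0); exact: normr_ge0.
exists (2 * L0); first by rewrite mulr_ge0.
move=> t x y z xy yz.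
have [E _] := derive_seq_affine t ws.
pose F x := derive1n 1 (model t) x.
have md u : is_der u (model t) (1 + derive1n 1 wave u).
  have := is_derive_add (is_derive_add (is_derive_id u (1 : R)) (is_derive_cst t u 1))
    (smooth_is_derive 0 u ws).
  by move/is_derive_eq; apply; rewrite addr0.
have w1 u : derive1n 1 wave u = dpsi (N%:R * u).
  have := is_derive_scale N%:R^-1 (is_derive1_comp (is_derive_psi b_gt0 b_small (N%:R * u))
    (is_derive_dilation N%:R u)).
  by move=> /is_derive_derive1; rewrite derive1n1 => ->; rewrite mulrCA mulVf// mulr1.
have [u1 /andP[xu1 u1y] ->] := mean_value md (ltW xy).
have [u2 /andP[yu2 u2z] ->] := mean_value md (ltW yz).
have lo : 2^-1 <= 1 + derive1n 1 wave u2.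
  by rewrite w1; have := dpsi_small (N%:R * u2); rewrite ler_norml; lra.
have := lipschitz (fun u => smooth_is_derive 1 u ws) (wb 1%N) u1 u2.
rewrite -/L0 => Lip.
have D : derive1n 1 wave u1 - derive1n 1 wave u2 <= L0 * (z - x).
  apply: le_trans (ler_norm _) _; apply: le_trans Lip _.
  by rewrite ler_wpM2l// ler_norml; lra.
have key : 1 + derive1n 1 wave u1 <=
    (1 + 2 * L0 * (z - x)) * (1 + derive1n 1 wave u2).
  have p : 0 <= L0 * (z - x) by rewrite mulr_ge0//; lra.
  have : 2 * (L0 * (z - x)) * 2^-1 <= 2 * (L0 * (z - x)) * (1 + derive1n 1 wave u2).
    by rewrite ler_wpM2l// mulr_ge0.
  lra.
have := ler_wpM2r (_ : 0 <= (y - x) * (z - y)) key.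
by rewrite mulr_ge0//; [move=> /(_ isT); lra|lra|lra].
Qed.

End Model.

(** * Periodic points of the Blaschke family *)

Section Cplx.
Variable R : realType.

Record cplx := Cplx { cre : R; cim : R }.

Definition cplx_pair (z : cplx) := (cre z, cim z).

Lemma cplx_pairK : cancel cplx_pair (fun p => Cplx p.1 p.2).
Proof. by case. Qed.

HB.instance Definition _ := Choice.copy cplx (can_type cplx_pairK).

Lemma cplx_eq (z w : cplx) : cre z = cre w -> cim z = cim w -> z = w.
Proof. by case: z w => [a b] [c d] /= -> ->. Qed.

Definition cplx_add (z w : cplx) := Cplx (cre z + cre w) (cim z + cim w).
Definition cplx_opp (z : cplx) := Cplx (- cre z) (- cim z).
Definition cplx_mul (z w : cplx) :=
  Cplx (cre z * cre w - cim z * cim w) (cre z * cim w + cim z * cre w).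
Definition cplx_norm2 (z : cplx) := cre z ^+ 2 + cim z ^+ 2.
Definition cplx_inv (z : cplx) :=
  Cplx (cre z / cplx_norm2 z) (- cim z / cplx_norm2 z).

Lemma cplx_addA : associative cplx_add.
Proof. by move=> x y z; apply: cplx_eq => /=; lra. Qed.
Lemma cplx_addC : commutative cplx_add.
Proof. by move=> x y; apply: cplx_eq => /=; lra. Qed.
Lemma cplx_add0 : left_id (Cplx 0 0) cplx_add.
Proof. by move=> x; apply: cplx_eq => /=; lra. Qed.
Lemma cplx_addN : left_inverse (Cplx 0 0) cplx_opp cplx_add.
Proof. by move=> x; apply: cplx_eq => /=; lra. Qed.

HB.instance Definition _ :=
  GRing.isZmodule.Build cplx cplx_addA cplx_addC cplx_add0 cplx_addN.

Lemma cplx_mulA : associative cplx_mul.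
Proof. by move=> x y z; apply: cplx_eq => /=; lra. Qed.
Lemma cplx_mulC : commutative cplx_mul.
Proof. by move=> x y; apply: cplx_eq => /=; lra. Qed.
Lemma cplx_mul1 : left_id (Cplx 1 0) cplx_mul.
Proof. by move=> x; apply: cplx_eq => /=; lra. Qed.
Lemma cplx_mulDl : left_distributive cplx_mul cplx_add.
Proof. by move=> x y z; apply: cplx_eq => /=; lra. Qed.
Lemma cplx_neq0 : Cplx 1 0 != Cplx 0 0.
Proof. by apply/eqP => -[] /eqP; rewrite oner_eq0. Qed.

HB.instance Definition _ := GRing.Zmodule_isComNzRing.Build cplx
  cplx_mulA cplx_mulC cplx_mul1 cplx_mulDl cplx_neq0.

Lemma cplx_norm2_eq0 (z : cplx) : (cplx_norm2 z == 0) = (z == 0).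
Proof.
apply/idP/eqP => [|->]; last by rewrite /cplx_norm2 /= !expr0n addr0.
rewrite paddr_eq0 ?sqr_ge0// !sqrf_eq0 => /andP[/eqP x0 /eqP y0].
exact: cplx_eq.
Qed.

Lemma cplx_mulV (z : cplx) : z != 0 -> cplx_mul (cplx_inv z) z = 1.
Proof.
rewrite -cplx_norm2_eq0 => z0; apply: cplx_eq => /=; last by lra.
have <- : cplx_norm2 z / cplx_norm2 z = 1 by rewrite divff.
by rewrite {3}/cplx_norm2; lra.
Qed.

Lemma cplx_inv0 : cplx_inv 0 = 0.
Proof. by apply: cplx_eq; rewrite /= ?oppr0 mul0r. Qed.

HB.instance Definition _ := GRing.ComNzRing_isField.Build cplx cplx_mulV cplx_inv0.

Lemma poly_roots_finite (F : fieldType) (p : {poly F}) : p != 0 ->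
  exists rs : seq F, forall z, root p z -> z \in rs.
Proof.
have [n] := ubnP (size p); elim: n p => // n IH p pn p0.
have [[z pz]|nz] := pselect (exists z, root p z); last first.
  by exists [::] => z pz; case: nz; exists z.
have [q E] := factor_theorem p z pz.
have q0 : q != 0 by apply: contraNneq p0 => q0; rewrite E q0 mul0r.
have [|rs rsP] := IH q _ q0.
  by rewrite -ltnS; apply: leq_trans pn; rewrite E size_Mmonic ?monicXsubC// size_XsubC addn2.
exists (z :: rs) => w; rewrite E rootM root_XsubC inE => /orP[/rsP->|->//].
by rewrite orbT.
Qed.

Definition cis (y : R) : cplx := Cplx (ccos y) (csin y).

Lemma cisD x y : cis (x + y) = cis x * cis y.
Proof.
apply: cplx_eq; rewrite /= /ccos /csin mulrDr ?cosD ?sinD//.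
by rewrite addrC mulrC (mulrC (sin _)) addrC; lra.
Qed.

Lemma cis_int (y : R) (p : int) : cis (y + p%:~R) = cis y.
Proof.
have c1 (z : R) : ccos (z + 1) + (z + 1) = ccos z + z + 1 by rewrite ccos1; lra.
have s1 (z : R) : csin (z + 1) + (z + 1) = csin z + z + 1 by rewrite csin1; lra.
apply: cplx_eq => /=.
  have := @shift_int _ (fun z => ccos z + z) c1 y p; lra.
have := @shift_int _ (fun z => csin z + z) s1 y p; lra.
Qed.

Lemma cis_natM (n : nat) (y : R) : cis (n%:R * y) = cis y ^+ n.
Proof.
elim: n => [|n IH]; last by rewrite exprSr -IH -cisD -natr1 mulrDl mul1r.
rewrite mul0r expr0; apply: cplx_eq; rewrite /= /ccos /csin mulr0 ?cos0 ?sin0//.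
Qed.

Lemma cis_inj x y : 0 <= x < 1 -> 0 <= y < 1 -> cis x = cis y -> x = y.
Proof.
wlog xy : x y / x <= y.
  by move=> H x1 y1 E; case: (leP x y) => [|/ltW] h; [|apply/esym]; exact: H.
move=> x1 y1 [cE sE].
have c1 : ccos (y - x) = 1.
  rewrite /ccos mulrBr cosB -/(ccos y) -/(ccos x) -/(csin x) -/(csin y) cE sE.
  by have := ccos2Dcsin2 y; lra.
apply/eqP; rewrite eq_le xy leNgt; apply/negP => lt_xy.
have : 0 < sin (pi * (y - x)).
  apply: sin_gt0_pi; rewrite mulr_gt0 ?pi_gt0 ?subr_gt0//=.
  by rewrite -[ltRHS]mulr1 ltr_pM2l ?pi_gt0//; lra.
have := cos2Dsin2 (pi * (y - x)); have := cos_mulr2n (pi * (y - x)).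
have -> : (pi * (y - x)) *+ 2 = 2 * pi * (y - x) by rewrite -mulr_natl; lra.
rewrite -/(ccos (y - x)) c1 => E1 E2 s0.
have : sin (pi * (y - x)) ^+ 2 = 0 by move: E1 E2; rewrite -mulr_natl; lra.
by move/eqP; rewrite sqrf_eq0 gt_eqF.
Qed.

End Cplx.

Section FinitelyPeriodic.
Variables (R : realType) (b : R).
Hypotheses (b_gt0 : 0 < b) (b_small : b <= 1000^-1).
Local Notation C := (cplx R).
Let beta : C := Cplx b 0.

Let b_lt1 : b < 1. Proof. by move: b_small; lra. Qed.

(** With [w = 1 - b / z], which is [Cplx D (b * csin y)], the three facts [cis psi * w = conj w],
    [z - b = z w] and [1 - b z = conj w] combine to the formula. *)
Lemma blaschke (y : R) :
  cis (circle_map b y) * (cis y - beta) = cis y ^+ 2 * (1 - beta * cis y).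
Proof.
have /andP[D0 _] := denom_bounds b_gt0 b_small y.
pose D := 1 - b * ccos y; have Dgt0 : 0 < D by rewrite (lt_le_trans _ D0).
pose A := atan (b * csin y / D).
pose ca := cos A; pose sa := sin A.
have ca0 : 0 < ca by apply: cos_gt0_pihalf; rewrite atan_gtNpi2 atan_ltpi2.
have saD : sa * D = b * csin y * ca.
  have := atanK (b * csin y / D); rewrite -/A /tan -/ca -/sa => /eqP.
  by rewrite (eqr_div _ _ (lt0r_neq0 ca0) (lt0r_neq0 Dgt0)) => /eqP.
have cs1 : ca ^+ 2 + sa ^+ 2 = 1 by exact: cos2Dsin2.
have psiA : 2 * pi * psi b y = - (A *+ 2).
  rewrite /psi -/D -/A -[A *+ 2]mulr_natl.
  have : pi * pi^-1 = 1 :> R by rewrite mulfV// gt_eqF// pi_gt0.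
  set q := pi^-1 => pq.
  have -> : 2 * pi * - (q * A) = - (2 * (pi * q) * A) by lra.
  by rewrite pq mulr1.
have cp : ccos (psi b y) = ca ^+ 2 - sa ^+ 2.
  by rewrite /ccos psiA cosN cos_mulr2n -/ca -mulr_natl; move: cs1; lra.
have sp : csin (psi b y) = - (2 * (sa * ca)).
  by rewrite /csin psiA sinN sin_mulr2n -/ca -/sa -mulr_natl; lra.
have E : cis (psi b y) * Cplx D (b * csin y) = Cplx D (- (b * csin y)).
  apply: cplx_eq; rewrite /= cp sp.
    have -> : (ca ^+ 2 - sa ^+ 2) * D - - (2 * (sa * ca)) * (b * csin y)
      = (ca ^+ 2 - sa ^+ 2) * D + 2 * sa * (b * csin y * ca) by lra.
    rewrite -saD.
    have -> : (ca ^+ 2 - sa ^+ 2) * D + 2 * sa * (sa * D) = (ca ^+ 2 + sa ^+ 2) * D by lra.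
    by rewrite cs1 mul1r.
  have -> : (ca ^+ 2 - sa ^+ 2) * (b * csin y) + - (2 * (sa * ca)) * D
      = (ca ^+ 2 - sa ^+ 2) * (b * csin y) - 2 * ca * (sa * D) by lra.
  rewrite saD.
  have -> : (ca ^+ 2 - sa ^+ 2) * (b * csin y) - 2 * ca * (b * csin y * ca)
     = - ((ca ^+ 2 + sa ^+ 2) * (b * csin y)) by lra.
  by rewrite cs1 mul1r.
have E1 : cis y - beta = cis y * Cplx D (b * csin y).
  apply: cplx_eq => /=; rewrite /D; last by lra.
  have := ccos2Dcsin2 y => h.
  have -> : ccos y * (1 - b * ccos y) - csin y * (b * csin y)
    = ccos y - b * (ccos y ^+ 2 + csin y ^+ 2) by lra.
  by rewrite h mulr1.
have E2 : 1 - beta * cis y = Cplx D (- (b * csin y)).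
  by apply: cplx_eq => /=; rewrite /D; lra.
rewrite E1 E2 /circle_map cisD -E expr2 -!mulrA; congr (_ * _).
by rewrite !mulrA (mulrC (cis (psi b y))).
Qed.

Variable lambda : C.

(** An unreduced numerator and denominator of the [n]-th iterate of [z -> lambda z^2 (1 - beta z) /
    (z - beta)], so that iteration stays within polynomials. *)
Fixpoint blaschke_iter (n : nat) : {poly C} * {poly C} :=
  if n is m.+1 then
    let: (P, Q) := blaschke_iter m in
    (lambda%:P * P ^+ 2 * (Q - beta%:P * P), Q ^+ 2 * (P - beta%:P * Q))
  else ('X, 1).

Local Notation P n := (blaschke_iter n).1.
Local Notation Q n := (blaschke_iter n).2.

Lemma blaschke_iterS n :
  blaschke_iter n.+1 = (lambda%:P * P n ^+ 2 * (Q n - beta%:P * P n),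
                        Q n ^+ 2 * (P n - beta%:P * Q n)).
Proof. by rewrite /=; case: (blaschke_iter n). Qed.

Let beta_neq0 : beta != 0.
Proof. by apply/eqP => -[] /eqP; rewrite gt_eqF. Qed.

Let beta_neqV : beta^-1 != beta.
Proof.
apply/eqP => E; have : beta * beta = 1 by rewrite -{2}E mulfV.
move=> [] bb _.
have : b * b < 1 * 1 by apply: ltr_pM => //; exact: ltW.
by move: bb; rewrite mulr0 subr0 mulr1 => ->; rewrite ltxx.
Qed.

Lemma blaschke_iter_hornerS n x :
  (P n.+1).[x] = lambda * (P n).[x] ^+ 2 * ((Q n).[x] - beta * (P n).[x]) /\
  (Q n.+1).[x] = (Q n).[x] ^+ 2 * ((P n).[x] - beta * (Q n).[x]).
Proof. by rewrite blaschke_iterS /= !hornerE !expr2 ?mulrA. Qed.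

(* [beta^-1] is a zero of the Blaschke map outside the circle: its orbit is
   [0, 0, ...], so that no iterate of the map is the identity. *)
Lemma blaschke_iter_pole n :
  (P n.+1).[beta^-1] = 0 /\ (Q n.+1).[beta^-1] != 0.
Proof.
elim: n => [|n [IHP IHQ]].
  have [-> ->] := blaschke_iter_hornerS 0 beta^-1.
  rewrite /= !hornerE mulfV// subrr mulr0; split=> //.
  by rewrite ?expr1n ?mul1r ?mulr1 subr_eq0.
have [-> ->] := blaschke_iter_hornerS n.+1 beta^-1.
rewrite IHP !mulr0 expr0n /= mulr0 mul0r sub0r; split=> //.
by rewrite mulf_neq0 ?expf_neq0// oppr_eq0 mulf_neq0.
Qed.

Lemma blaschke_iter_neq0 n : (0 < n)%N -> P n - 'X * Q n != 0.
Proof.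
case: n => // n _; have [Pn Qn] := blaschke_iter_pole n.
apply/eqP => /(congr1 (fun p => p.[beta^-1])).
rewrite !hornerE Pn sub0r => /eqP.
by rewrite oppr_eq0 mulf_eq0 invr_eq0 (negbTE beta_neq0) (negbTE Qn).
Qed.

Lemma cis_neq_beta y : cis y - beta != 0.
Proof.
rewrite subr_eq0; apply/eqP => -[cb sb].
have := ccos2Dcsin2 y; rewrite cb sb expr0n addr0 => bb.
have : b * b < 1 * 1 by apply: ltr_pM => //; exact: ltW.
by rewrite -expr2 bb mulr1 ltxx.
Qed.

(** On the unit circle the denominators cannot vanish: each new factor is [z - beta] times a nonzero
    number, with [beta] inside the disc. *)
Lemma blaschke_iterP (g : R -> R) y :
  (forall y, cis (g y) = lambda * cis (circle_map b y)) ->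
  forall n, (Q n).[cis y] != 0 /\
    cis (iter n g y) * (Q n).[cis y] = (P n).[cis y].
Proof.
move=> gE; elim=> [|n [Qn E]].
  by rewrite /= !hornerE oner_eq0 ?mulr1.
have [-> ->] := blaschke_iter_hornerS n (cis y); rewrite -E.
set z := cis (iter n g y); set q := (Q n).[cis y] in Qn *.
have -> : z * q - beta * q = (z - beta) * q by rewrite mulrBl.
split; first by rewrite !mulf_neq0 ?expf_neq0// cis_neq_beta.
rewrite iterS gE.
have -> : q - beta * (z * q) = (1 - beta * z) * q by rewrite mulrBl mul1r mulrA.
have -> : lambda * cis (circle_map b (iter n g y)) * (q ^+ 2 * ((z - beta) * q))
    = lambda * (cis (circle_map b (iter n g y)) * (z - beta) * (q ^+ 2 * q)).
  by rewrite (mulrCA (q ^+ 2)) !mulrA.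
by rewrite blaschke -/z exprMn -[RHS]mulrA; congr (_ * _); rewrite mulrACA.
Qed.

End FinitelyPeriodic.

(** * Oscillation of the displacement, rotation number and periodic points of the model *)

Section Oscillation.
Variables (R : realType) (b : R).
Hypotheses (b_gt0 : 0 < b) (b_small : b <= 1000^-1).
Implicit Types (x y z s t tau a : R).

Lemma sin_le x : `|sin x| <= `|x|.
Proof.
have := @lipschitz R sin cos 1 (fun x => is_derive_sin x) _ x 0.
rewrite sin0 !subr0 mul1r; apply => z.
by rewrite ler_norml cos_geN1 cos_le1.
Qed.

Lemma atan_ge (x : R) : 0 <= x <= 1 -> x / 2 <= atan x.
Proof.
move=> /andP[x0 x1].
have [z /andP[z0 zx]] := mean_value (fun z : R => is_derive1_atan z) x0.
rewrite atan0 !subr0 => ->; rewrite mulrC ler_wpM2r//.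
rewrite lef_pV2 ?posrE//; last by rewrite ltr_pwDl// sqr_ge0.
have : z ^+ 2 <= 1 by rewrite expr_le1//; lra.
lra.
Qed.

(** The sine equals [1 - 2 sin^2 u] with [u = pi (s - 1/2) / 2], and [pi < 4] already gives
    [|u| <= 0.22]. *)
Lemma sin_pi_ge s : 39 / 100 <= s <= 61 / 100 -> 2^-1 <= sin (pi * s).
Proof.
move=> s12.
pose u := pi * (s - 2^-1) / 2.
have -> : pi * s = u *+ 2 + pi / 2 by rewrite -mulr_natl /u; lra.
rewrite sinDpihalf cos_mulr2n -mulr_natl.
have c2 := cos2Dsin2 u.
have u1 : `|u| <= 22 / 100.
  have pi4 := pi_lt4 R; have pi0 := pi_gt0 R.
  rewrite /u normrM normrM gtr0_norm// (ger0_norm (_ : 0 <= 2^-1)) ?invr_ge0//.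
  have : `|s - 2^-1| <= 11 / 100 by rewrite ler_norml; lra.
  move=> H; have := ler_pM (ltW pi0) (normr_ge0 _) (ltW pi4) H; lra.
have := le_trans (sin_le u) u1 => su.
have : `|sin u| * `|sin u| <= (22 / 100) * (22 / 100) by rewrite ler_pM.
rewrite -expr2 real_normK ?num_real//; lra.
Qed.

Lemma psi_half s : psi b (s / 2) = - (pi^-1 * atan (b * sin (pi * s) / (1 - b * cos (pi * s)))).
Proof.
have E : 2 * pi * (s / 2) = pi * s by lra.
by rewrite /psi /csin /ccos E.
Qed.

Lemma psi_half' s : psi b (s / 2 + 2^-1) =
  pi^-1 * atan (b * sin (pi * s) / (1 + b * cos (pi * s))).
Proof.
have E : 2 * pi * (s / 2) = pi * s by lra.
by rewrite /psi csin_half ccos_half /csin /ccos E !mulrN opprK mulNr atanN mulrN opprK.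
Qed.

(** Replacing the inverse map by the translation by [- s] costs [25 b^2 <= b / 40]. As [psi] is odd,
    [psi y - psi (y - s)] equals [2 psi y] at [s / 2] and at [s / 2 + 1/2]. There [psi] is about
    [- b sin(pi s) / pi] and its opposite, and [sin(pi s)] is large for [s] near 1/2. *)
Lemma displacement_oscillation tau (p : int) :
  39 / 100 <= tau - p%:~R <= 61 / 100 ->
  exists y y', b / 20 <= displacement b tau y - displacement b tau y'.
Proof.
move=> sP; set s := tau - p%:~R in sP.
exists (s / 2 + 2^-1), (s / 2).
have approx y : `|displacement b tau y - (psi b y - psi b (y - s))| <= b / 40.
  have -> : psi b (y - s) = psi b (y - tau).
    have F z : psi b (z + 1) + (z + 1) = psi b z + z + 1 by rewrite psi1 addrA.
    have := shift_int F (y - tau) p.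
    have -> : y - tau + p%:~R = y - s by rewrite /s; lra.
    by rewrite /s; lra.
  have -> : displacement b tau y - (psi b y - psi b (y - tau))
      = psi b (y - tau) - psi b (circle_inv b tau y) by rewrite /displacement; lra.
  apply: le_trans (psi_lipschitz b_gt0 b_small _ _) _.
  have := circle_invE b_gt0 b_small tau y => ciE.
  have -> : y - tau - circle_inv b tau y = psi b (circle_inv b tau y).
    by rewrite {1}ciE; lra.
  have := psi_le b_gt0 b_small (circle_inv b tau y) => H.
  have : 5 * b * `|psi b (circle_inv b tau y)| <= 5 * b * (5 * b).
    by rewrite ler_wpM2l// mulr_ge0// ltW.
  have : b * b <= b * 1000^-1 by rewrite ler_wpM2l// ltW.
  by move: b_gt0; lra.
have E1 : psi b (s / 2 - s) = - psi b (s / 2) by rewrite -psiN; congr psi; lra.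
have E2 : psi b (s / 2 + 2^-1 - s) = - psi b (s / 2 + 2^-1).
  have -> : s / 2 + 2^-1 - s = - (s / 2 + 2^-1) + 1 by lra.
  by rewrite psi1 psiN.
have := approx (s / 2); have := approx (s / 2 + 2^-1).
rewrite E1 E2 psi_half psi_half'.
have sg := sin_pi_ge sP.
have D1 (c : R) : -1 <= c -> c <= 1 -> 2^-1 <= 1 + b * c <= 2.
  move=> c1 c2.
  have H1 : b * c <= b * 1 by rewrite ler_wpM2l// ltW.
  have H2 : b * (-1) <= b * c by rewrite ler_wpM2l// ltW.
  by move: b_small; lra.
have key (c : R) : -1 <= c -> c <= 1 -> b / 8 <= atan (b * sin (pi * s) / (1 + b * c)).
  move=> c1 c2; have /andP[d1 d2] := D1 c c1 c2.
  have d0 : 0 < 1 + b * c by lra.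
  have lo : b / 4 <= b * sin (pi * s) / (1 + b * c).
    rewrite ler_pdivlMr//.
    have : b / 4 * (1 + b * c) <= b / 4 * 2 by rewrite ler_wpM2l// divr_ge0// ltW.
    have : b * 2^-1 <= b * sin (pi * s) by rewrite ler_wpM2l// ltW.
    lra.
  have up : b * sin (pi * s) / (1 + b * c) <= 1.
    rewrite ler_pdivrMr// mul1r.
    have : b * sin (pi * s) <= b * 1 by rewrite ler_wpM2l ?sin_le1// ltW.
    by move: b_small; lra.
  apply: le_trans (atan_ge _); first by lra.
  by rewrite up andbT; move: b_gt0; lra.
have k1 := key (cos (pi * s)) (cos_geN1 _) (cos_le1 _).
have k2 : b / 8 <= atan (b * sin (pi * s) / (1 - b * cos (pi * s))).
  by rewrite -mulrN; apply: key; rewrite ?lerN2 ?cos_le1// lerNl cos_geN1.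
have pv : 4^-1 <= pi^-1 :> R by rewrite lef_pV2 ?posrE ?pi_gt0// ltW// pi_lt4.
have b8 : 0 <= b / 8 by rewrite divr_ge0// ltW.
have q0 : 0 <= 4^-1 :> R by rewrite invr_ge0.
have := ler_pM q0 b8 pv k1; have := ler_pM q0 b8 pv k2.
by rewrite !ler_norml; move: b_gt0; lra.
Qed.

Lemma conj_rotation_ge f h a (r : R) : lift f -> lift h ->
  (forall x, h (f x) = h x + a) -> (forall x, x + r <= f x) -> r <= a.
Proof.
move=> fl hl hf fr; rewrite leNgt; apply/negP => ar.
have it n : n%:R * r <= iter n f 0.
  elim: n => [|n IH]; first by rewrite mul0r.
  by rewrite iterS; have := fr (iter n f 0); rewrite -natr1; lra.
pose n := (Num.truncn (r - a)^-1).+1.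
have : 1 < n%:R * (r - a) by rewrite -ltr_pdivrMr ?subr_gt0// div1r truncnS_gt.
have := it n; have := lift_displacement hl 0 (iter n f 0).
by rewrite (semiconj_iter hf); lra.
Qed.

Lemma conj_rotation_le f h a (r : R) : lift f -> lift h ->
  (forall x, h (f x) = h x + a) -> (forall x, f x <= x + r) -> a <= r.
Proof.
move=> fl hl hf fr; rewrite leNgt; apply/negP => ar.
have it n : iter n f 0 <= n%:R * r.
  elim: n => [|n IH]; first by rewrite mul0r.
  by rewrite iterS; have := fr (iter n f 0); rewrite -natr1; lra.
pose n := (Num.truncn (a - r)^-1).+1.
have : 1 < n%:R * (a - r) by rewrite -ltr_pdivrMr ?subr_gt0// div1r truncnS_gt.
have := it n; have := lift_displacement hl (iter n f 0) 0.
by rewrite (semiconj_iter hf); lra.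
Qed.

Variable N : nat.
Hypothesis N_gt0 : (0 < N)%N.
Let N0 : 0 < N%:R :> R. Proof. by rewrite ltr0n. Qed.

(** The wave moves points by at most [5 b / N], so the rotation number is that close to [t]. Thus
    [N t] is controlled by [N a]. *)
Lemma model_rotation_close t h a : lift h ->
  (forall x, h (model b N t x) = h x + a) -> `|N%:R * t - N%:R * a| <= 5 * b.
Proof.
move=> hl hf; have fl := model_lift b_gt0 b_small N_gt0 t.
have w x := wave_le b_gt0 b_small N x.
have lo : t - N%:R^-1 * (5 * b) <= a.
  apply: (conj_rotation_ge fl hl hf) => x; rewrite /model /fam.
  by have := w x; rewrite ler_norml; lra.
have up : a <= t + N%:R^-1 * (5 * b).
  apply: (conj_rotation_le fl hl hf) => x; rewrite /model /fam.
  by have := w x; rewrite ler_norml; lra.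
rewrite -mulrBr normrM (gtr0_norm N0) -ler_pdivlMl// ler_norml; lra.
Qed.

(** Multiplication by [N] carries a solution [x] to a point that [g] returns to itself modulo 1
    after [q] steps. Then [cis (N x)], the [N]-th power of [cis x], is a root of [H], so [cis x] is
    a root of [H] composed with ['X^N]. *)
Lemma model_finitely_periodic (q : nat) (p : int) t : (0 < q)%N ->
  exists zs : seq R, forall x, 0 <= x <= 1 ->
    iter q (model b N t) x = x + p%:~R -> x \in zs.
Proof.
move=> q0; pose g y := circle_map b y + N%:R * t.
have gE y : cis (g y) = cis (N%:R * t) * cis (circle_map b y).
  by rewrite /g cisD mulrC.
have itE n x : N%:R * iter n (model b N t) x = iter n g (N%:R * x).
  by elim: n => // n IH; rewrite !iterS modelE// IH.
pose H := (blaschke_iter b (cis (N%:R * t)) q).1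
  - 'X * (blaschke_iter b (cis (N%:R * t)) q).2.
have H0 : H != 0 by exact: blaschke_iter_neq0.
have HN0 : H \Po 'X^N != 0.
  by rewrite comp_poly_eq0// size_polyXn ltnS.
have [rs rsP] := poly_roots_finite HN0.
pose pick (r : cplx R) : R := xget 0 [set x | 0 <= x < 1 /\ cis x = r].
(* [pick] recovers angles in [[0, 1[], where [cis] is injective; the endpoint 1 is listed apart. The
   default 0 of [xget] only concerns roots off the circle. *)
exists (1 :: map pick rs) => x /andP[x0 x1] fx.
rewrite inE; have [//|xn1] := eqVneq x 1; apply/mapP.
have x01 : 0 <= x < 1 by rewrite x0 lt_neqAle xn1.
exists (cis x); last first.
  rewrite /pick; case: xgetP => [y _ [y01 yx]|/(_ x)]; last by case.
  exact: cis_inj.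
apply: rsP; rewrite /root horner_comp hornerXn -cis_natM.
have [_ PQ] := blaschke_iterP b_gt0 b_small (N%:R * x) gE q.
rewrite /H !hornerE -PQ -itE fx mulrDr.
have -> : N%:R * p%:~R = (N%:Z * p)%:~R :> R by rewrite intrM.
by rewrite cis_int subrr.
Qed.

End Oscillation.

(** * Norms *)

Section Norms.
Variable R : realType.
Implicit Types (x y t tau a : R).

Lemma sup_norm_le (f : R -> R) (M : R) : (forall x, `|f x| <= M) ->
  (sup_norm f <= M%:E)%E.
Proof. by move=> H; apply: ge_ereal_sup => _ [x _ <-]; rewrite lee_fin. Qed.

Lemma sup_norm_ge (f : R -> R) x : (`|f x|%:E <= sup_norm f)%E.
Proof. by apply: ereal_sup_ubound; exists x. Qed.

Lemma sup_norm_ge0 (f : R -> R) : (0 <= sup_norm f)%E.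
Proof. by apply: le_trans (sup_norm_ge f 0); rewrite lee_fin. Qed.

Lemma Cnorm_nat_ge (f : R -> R) (n : nat) x :
  (`|derive1n n f x|%:E <= Cnorm n%:R f)%E.
Proof.
rewrite /Cnorm natrK subrr eqxx big_nat_recr//=.
apply: le_trans (sup_norm_ge _ x) _.
by rewrite leeDr// sume_ge0// => i _; exact: sup_norm_ge0.
Qed.

Lemma Cnorm_frac_le (f : R -> R) (m : nat) (eps M K : R) : 0 < eps -> eps < 1 ->
  (forall i x, (i <= m)%N -> `|derive1n i f x| <= M) ->
  (forall x y, x != y ->
    `|derive1n m f x - derive1n m f y| <= K * `|x - y| `^ (1 - eps)) ->
  (Cnorm (m.+1%:R - eps) f <= (m.+1%:R * M + K)%:E)%E.
Proof.
move=> e0 e1 fM fK.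
have tr : Num.truncn (m.+1%:R - eps) = m.
  by apply: truncn_def; rewrite -natr1; lra.
have th : m.+1%:R - eps - m%:R = 1 - eps by rewrite -natr1; lra.
rewrite /Cnorm tr th gt_eqF ?subr_gt0// EFinD; apply: leeD.
  rewrite big_mkord; apply: (@le_trans _ _ (\sum_(i < m.+1) M%:E)%E).
    by apply: lee_sum => i _; apply: sup_norm_le => x; apply: fM; rewrite -ltnS.
  by rewrite sumEFin sumr_const card_ord mulr_natl.
apply: ge_ereal_sup => _ [[p q] /= pq <-]; rewrite lee_fin.
rewrite ler_pdivrMr ?fK// powR_gt0// normr_gt0 subr_eq0//.
Qed.

Section Model.
Variables (b : R) (N : nat) (t : R).
Hypotheses (b_gt0 : 0 < b) (b_small : b <= 1000^-1) (N_gt0 : (0 < N)%N).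
Let N0 : 0 < N%:R :> R. Proof. by rewrite ltr0n. Qed.
Let N1 : 1 <= N%:R :> R. Proof. by rewrite ler1n. Qed.
Let V := displacement b (N%:R * t).
Let phi := Phi (model b N t).

Lemma displacement_smooth : smooth V.
Proof. by have [] := displacement_growth b_gt0 b_small (N%:R * t). Qed.

Lemma Phi_model_derive1n : (forall k, derive1n k phi =
    fun x => (2 * N%:R)^-1 * N%:R ^+ k * derive1n k V (N%:R * x)) /\ smooth phi.
Proof.
have -> : phi = fun x => (2 * N%:R)^-1 * V (N%:R * x).
  by apply/funext => x; exact: Phi_modelE.
exact: derive_seq_dilation displacement_smooth.
Qed.

Lemma Phi_model_smooth_circle : smooth_circle phi.
Proof.
split; last by have [_] := Phi_model_derive1n.
move=> x; rewrite /phi !Phi_modelE// (@periodic_dilation _ N (displacement b (N%:R * t)))//.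
by move=> y; exact: displacement1.
Qed.

(** A sum instead of a maximum, since it dominates each term: 10 serves for order 0, and the second
    summand for order [j + 1]. It involves neither [b] nor [N]. *)
Definition derivative_bound (m : nat) : R :=
  \sum_(j < m.+2) (10 + 20 * growth_rate R ^+ j * j`!%:R).

Lemma displacement_derive_le m i y : (i <= m.+1)%N ->
  `|derive1n i V y| <= derivative_bound m * b.
Proof.
move=> im; have g0 := growth_rate_ge0 R.
have term_ge0 (j : nat) : 0 <= 20 * growth_rate R ^+ j * j`!%:R :> R.
  by rewrite !mulr_ge0// exprn_ge0.
have ge (j : 'I_m.+2) : 10 + 20 * growth_rate R ^+ j * j`!%:R <= derivative_bound m.
  rewrite /derivative_bound (bigD1 j)//= lerDl sumr_ge0// => k _.
  by rewrite addr_ge0.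
case: i im => [|i] im.
  apply: le_trans (displacement_le b_gt0 b_small _ _) _.
  rewrite ler_pM2r//; apply: le_trans (ge ord0); rewrite lerDl.
  exact: (term_ge0 0%N).
have [_ /(_ i y)] := displacement_growth b_gt0 b_small (N%:R * t).
move=> /le_trans; apply.
have := ge (Ordinal (ltnW im : (i < m.+2)%N)) => /= H.
have : (10 + 20 * growth_rate R ^+ i * i`!%:R) * b <= derivative_bound m * b.
  by rewrite ler_pM2r.
by move: b_gt0; lra.
Qed.

Lemma derivative_bound_ge0 m : 0 <= derivative_bound m.
Proof.
have := displacement_derive_le 0 (leq0n m.+1).
move/(le_trans (normr_ge0 _)).
by rewrite pmulr_lge0.
Qed.

Lemma Cnorm_Phi_model_le (m : nat) (eps : R) : 0 < eps -> eps < 1 ->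
  (Cnorm (m.+1%:R - eps) phi <= (m.+2%:R * derivative_bound m * b
     * (N%:R ^+ m / N%:R) * N%:R `^ (1 - eps))%:E)%E.
Proof.
move=> e0 e1; set La := derivative_bound m.
have La0 : 0 <= La := derivative_bound_ge0 m.
have [E _] := Phi_model_derive1n.
have Nth : 1 <= N%:R `^ (1 - eps).
  by rewrite -[leLHS](powRr0 (N%:R : R)) ler_powR//; lra.
pose c := N%:R ^+ m / N%:R : R.
have c0 : 0 <= c by rewrite divr_ge0 ?exprn_ge0.
have Lb0 : 0 <= La * b by rewrite mulr_ge0 ?(ltW b_gt0).
have half k : (k <= m)%N -> (2 * N%:R)^-1 * N%:R ^+ k <= 2^-1 * c.
  move=> km; rewrite invfM -mulrA ler_wpM2l ?invr_ge0// /c [leRHS]mulrC.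
  by rewrite ler_wpM2l ?invr_ge0// ler_weXn2l.
have hge0 k : 0 <= (2 * N%:R)^-1 * N%:R ^+ k :> R.
  by rewrite mulr_ge0 ?invr_ge0 ?mulr_ge0 ?exprn_ge0.
apply: (@le_trans _ _ (m.+1%:R * (La * b * c) + La * b * c * N%:R `^ (1 - eps))%:E).
  apply: Cnorm_frac_le => // [i x im|x y xy].
    rewrite E normrM (ger0_norm (hge0 i)).
    have := ler_pM (hge0 i) (normr_ge0 _) (half i im)
      (displacement_derive_le (N%:R * x) (leqW im)).
    have : 0 <= La * b * c by rewrite mulr_ge0.
    by rewrite -/La; lra.
  rewrite !E -mulrBr normrM (ger0_norm (hge0 m)).
  set W := derive1n m V.
  have xy0 : 0 < `|x - y| by rewrite normr_gt0 subr_eq0.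
  have W1 := displacement_derive_le (N%:R * x) (leqnSn m).
  have W2 := displacement_derive_le (N%:R * y) (leqnSn m).
  have L := lipschitz (fun u => smooth_is_derive m u displacement_smooth)
    (fun u => displacement_derive_le u (leqnn m.+1)) (N%:R * x) (N%:R * y).
  rewrite -/W -/La in W1 W2 L.
  have NE : `|N%:R * x - N%:R * y| = N%:R * `|x - y|.
    by rewrite -mulrBr normrM ger0_norm.
  rewrite NE in L.
  have key : `|W (N%:R * x) - W (N%:R * y)|
      <= 2 * (La * b) * (N%:R `^ (1 - eps) * `|x - y| `^ (1 - eps)).
    rewrite -powRM//; set d := N%:R * `|x - y| in L *.
    have d0 : 0 < d by rewrite mulr_gt0.
    (* Interpolation at the scale [1 / N]: far points use the supremum bound, near points the
       Lipschitz bound and [d <= d^(1 - eps)]. *)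
    have [d1|d1] := leP 1 d.
      have p1 : 1 <= d `^ (1 - eps) by rewrite -[leLHS](powRr0 d) ler_powR//; lra.
      have : 2 * (La * b) * 1 <= 2 * (La * b) * d `^ (1 - eps).
        by rewrite ler_wpM2l// mulr_ge0.
      by have := ler_normB (W (N%:R * x)) (W (N%:R * y)); lra.
    have p1 : d <= d `^ (1 - eps) by rewrite ger1_powR ?d0 ?ltW//; lra.
    have : La * b * d <= La * b * d `^ (1 - eps) by rewrite ler_wpM2l.
    have : 0 <= La * b * d `^ (1 - eps) by rewrite mulr_ge0 ?powR_ge0.
    by lra.
  have := ler_pM (hge0 m) (normr_ge0 _) (half m (leqnn m)) key; lra.
rewrite lee_fin -/c.
have h1 : La * b * c <= La * b * c * N%:R `^ (1 - eps).
  by rewrite ler_peMr// mulr_ge0.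
have : m.+1%:R * (La * b * c) <= m.+1%:R * (La * b * c * N%:R `^ (1 - eps)).
  by rewrite ler_wpM2l.
by rewrite -(natr1 m.+1); lra.
Qed.

(** A small top derivative of [Phi] bounds that of [V] by [2 delta N / N^(m + 1)], hence also the
    oscillation of the periodic function [V], which is at least [b / 20]. *)
Lemma Cnorm_Phi_model_ge (m : nat) (delta : R) (p : int) :
  39 / 100 <= N%:R * t - p%:~R <= 61 / 100 ->
  (Cnorm m.+1%:R phi < delta%:E)%E -> b * N%:R ^+ m <= 40 * delta.
Proof.
move=> tp cd; have [E _] := Phi_model_derive1n.
have [y [y' yy']] := displacement_oscillation b_gt0 b_small tp.
have bd u : `|derive1n m.+1 V u| <= delta * (2 * N%:R) / N%:R ^+ m.+1.
  have := le_lt_trans (Cnorm_nat_ge phi m.+1 (N%:R^-1 * u)) cd.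
  rewrite lte_fin E mulVKf ?gt_eqF// => /ltW.
  have q0 : 0 < (2 * N%:R)^-1 * N%:R ^+ m.+1 :> R.
    by rewrite mulr_gt0 ?invr_gt0 ?mulr_gt0 ?exprn_gt0.
  rewrite normrM (gtr0_norm q0) -ler_pdivlMl// => /le_trans; apply.
  by rewrite invfM invrK; lra.
have := periodic_oscillation_derive1n displacement_smooth
  (fun z => displacement1 b_gt0 b_small _ z) bd y y'.
move=> /(le_trans (ler_norm _)) /(le_trans yy').
rewrite ler_pdivlMr ?exprn_gt0// exprSr => H.
rewrite -(ler_pM2r N0); lra.
Qed.

End Model.
End Norms.

(** * Residual sets of rotation numbers *)

Section Residual.
Variable R : realType.
Implicit Types (x y t a : R) (p : int).

Lemma model_conjugate (b : R) (N : nat) a : 0 < b -> b <= 1000^-1 -> (0 < N)%N ->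
  irrational a -> exists t h, lift h /\ forall x, h (model b N t x) = h x + a.
Proof.
move=> b0 bs N0 ia.
have [t ta] := fam_order_rot (@wave_continuous _ _ b0 bs N) (wave1 b N)
  (wave_le1 b0 bs N0) (wave_incr b0 bs N0) a.
have fl := model_lift b0 bs N0 t.
have [h [hc hm h1 hf]] := semiconjugacy fl ia ta.
exists t, h; split=> //; split=> // x y xy.
have [L L0 dist] := model_distortion b0 bs N0.
rewrite lt_neqAle hm ?(ltW xy)// andbT; apply/eqP.
exact: (no_flat_piece fl ia L0 hc hm h1 hf (dist t)).
Qed.

Lemma powR_large (e T : R) : 0 < e ->
  exists N0 : nat, forall N : nat, (N0 <= N)%N -> T < N%:R `^ e.
Proof.
move=> e0; pose T' := `|T| + 1.
have T'0 : 0 <= T' by rewrite addr_ge0.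
exists (Num.truncn (T' `^ e^-1)).+1 => N NN.
have TT' : T < T' by apply: le_lt_trans (ler_norm T) _; rewrite ltrDl.
apply: lt_le_trans TT' _.
have -> : T' = (T' `^ e^-1) `^ e by rewrite -powRrM mulVf ?gt_eqF// powRr1.
apply: ge0_ler_powR; rewrite ?nnegrE ?powR_ge0// ?ltW//.
by apply: lt_le_trans (truncnS_gt _) _; rewrite ler_nat.
Qed.

(** Here [m] is [iota - 1]. The factor 1/1000, together with [eps / 2 <= m], keeps the amplitude in
    the admissible range for every [N >= 1]. *)
Definition amplitude (m : nat) (eps : R) (N : nat) : R :=
  1000^-1 * (N%:R `^ (eps / 2) / N%:R ^+ m).

Section Amplitude.
Variables (m : nat) (eps : R).
Hypotheses (m_gt0 : (0 < m)%N) (eps_gt0 : 0 < eps) (eps_lt1 : eps < 1).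

Lemma amplitude_gt0 N : (0 < N)%N -> 0 < amplitude m eps N.
Proof.
move=> N0; have N0' : 0 < N%:R :> R by rewrite ltr0n.
by rewrite /amplitude mulr_gt0 ?invr_gt0 ?ltr0n// divr_gt0 ?exprn_gt0 ?powR_gt0.
Qed.

Lemma amplitude_small N : (0 < N)%N -> amplitude m eps N <= 1000^-1.
Proof.
move=> N0; have N1 : 1 <= N%:R :> R by rewrite ler1n.
have Nm : 0 < N%:R ^+ m :> R by rewrite exprn_gt0 ?ltr0n.
rewrite /amplitude ler_piMr ?invr_ge0 ?ler0n// ler_pdivrMr// mul1r.
apply: (@le_trans _ _ (N%:R)); first by rewrite ler1_powR//; move: eps_lt1; lra.
by rewrite -[leLHS]expr1 ler_weXn2l.
Qed.

(** Quantified over all [t] and [h], because neither is known when the residual set is built. *)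
Definition singular_at (N n q : nat) p (r : R) := forall a t h, lift h ->
  (forall x, h (model (amplitude m eps N) N t x) = h x + a) ->
  p%:~R < q%:R * a -> q%:R * a < p%:~R + r ->
  exists (M : nat) (B : {set 'I_M}), [/\ (0 < M)%N, #|B|%:R < n.+1%:R^-1 * M%:R :> R &
    2^-1 <= \sum_(j in B) (h (j.+1%:R / M%:R) - h (j%:R / M%:R))].

Lemma singular_at_exists (N n q : nat) p : (0 < N)%N -> (0 < q)%N ->
  exists2 r : R, 0 < r <= (n.+1%:R * q%:R)^-1 & singular_at N n q p r.
Proof.
move=> N0 q0; have b0 := amplitude_gt0 N0; have bs := amplitude_small N0.
have d0 : 0 < n.+1%:R^-1 :> R by rewrite invr_gt0.
have [c c0 H] := singular_near_rational (@wave_continuous _ _ b0 bs N) (wave1 _ N)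
  (wave_le1 b0 bs N0) (wave_incr b0 bs N0) (model_finitely_periodic b0 bs N0) p q0 d0.
exists (Num.min c (n.+1%:R * q%:R)^-1).
  by rewrite lt_min c0 invr_gt0 mulr_gt0 ?ltr0n//= ge_min lexx orbT.
move=> a t h hl hf pa ap; apply: (H a t h hl hf pa).
by apply: lt_le_trans ap _; rewrite lerD2l ge_min lexx.
Qed.

(* The bound on [r] makes every point of [\bigcap_n liouville N n]
   irrational. *)
Definition liouville (N n : nat) : set R := [set a | exists (q : nat) p (r : R),
  [/\ (0 < q)%N, 0 < r <= (n.+1%:R * q%:R)^-1, singular_at N n q p r,
      p%:~R < q%:R * a & q%:R * a < p%:~R + r]].

Lemma liouville_open N n : open (liouville N n).
Proof.
rewrite openE => a [q [p [r [q0 r0 s pa ap]]]].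
have q0' : 0 < q%:R :> R by rewrite ltr0n.
have ai : a \in `](p%:~R / q%:R), ((p%:~R + r) / q%:R)[.
  by rewrite in_itv /= ltr_pdivrMr// ltr_pdivlMr// mulrC pa.
have := near_in_itvoo ai; apply: filterS => x.
rewrite /= in_itv /= ltr_pdivrMr// ltr_pdivlMr// mulrC => /andP[px xp].
by exists q, p, r.
Qed.

Lemma liouville_dense N n : (0 < N)%N ->
  `[0, 1]%classic `<=` closure (liouville N n `&` `[0, 1]%classic).
Proof.
move=> N0 x; rewrite /= in_itv /= => /andP[x0 x1] B /nbhs_ballP[e /= e0 eB].
pose e' := Num.min (e / 2) 2^-1.
have e'0 : 0 < e' by rewrite lt_min divr_gt0//= invr_gt0.
have e'1 : e' <= 2^-1 by rewrite ge_min lexx orbT.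
have e'2 : e' <= e / 2 by rewrite ge_min lexx.
(* Shrinking towards 0 makes [y < 1], which leaves room inside [[0, 1]] to the right of the fraction
   [p / q], even for [x = 1]. *)
pose y := x * (1 - e').
have xe' : x * e' <= 1 * e' by rewrite ler_wpM2r// ltW.
have xe'0 : 0 <= x * e' by rewrite mulr_ge0// ltW.
have y0 : 0 <= y by rewrite mulr_ge0//; lra.
have y1 : y < 1.
  have : x * (1 - e') <= 1 * (1 - e') by rewrite ler_wpM2r//; lra.
  by rewrite /y; lra.
pose q := (Num.truncn (e / 2)^-1).+1.
have qe : 1 < q%:R * (e / 2) by rewrite -ltr_pdivrMr ?divr_gt0// div1r truncnS_gt.
have q0 : 0 < q%:R :> R by rewrite ltr0n.
pose p := Num.floor (q%:R * y).
have /andP[p1 p2] := floor_itv (q%:R * y); rewrite -/p intrD in p1 p2.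
have p0 : 0 <= p%:~R :> R by rewrite ler0z floor_ge0 mulr_ge0// ltW.
have [r /andP[r0 rn] s] := singular_at_exists n p N0 (isT : (0 < q)%N).
pose z : R := p%:~R / q%:R.
have qz : q%:R * z = p%:~R by rewrite /z mulrC divfK// gt_eqF.
have z0 : 0 <= z by rewrite divr_ge0// ltW.
have zy : z <= y by rewrite ler_pdivrMr// mulrC.
have yz : y - z < e / 2.
  by rewrite -(ltr_pM2l q0) mulrBr qz; lra.
pose d := Num.min (r / q%:R) (Num.min (x + e - z) (1 - z)).
have yx : y = x - x * e' by rewrite /y; lra.
have d0 : 0 < d by rewrite !lt_min divr_gt0//=; apply/andP; split; lra.
have d1 : d <= r / q%:R by rewrite ge_min lexx.
have d2 : d <= x + e - z by rewrite !ge_min lexx orbT.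
have d3 : d <= 1 - z by rewrite !ge_min lexx !orbT.
have qd : q%:R * d <= r by rewrite mulrC -ler_pdivlMr.
have qd0 : 0 < q%:R * d by rewrite mulr_gt0.
exists (z + d / 2); split; last first.
  by apply: eB; rewrite /ball /= ltr_norml; lra.
split; last by rewrite /= in_itv /=; lra.
exists q, p, r; split=> //; first by rewrite r0.
  by rewrite mulrDr qz; lra.
by rewrite mulrDr qz; lra.
Qed.

(** If [q0 a = p0], then [q0 (q a - p)] is the integer [q p0 - q0 p]. Membership with index [n = q0]
    puts it strictly between 0 and 1. *)
Lemma liouville_irrational N a : (forall n, liouville N n a) -> irrational a.
Proof.
move=> H q0 p0 q0_gt0 E.
have [q [p [r [qq /andP[r0 rn] _ pa ap]]]] := H q0.
have q0' : 0 < q0%:R :> R by rewrite ltr0n.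
have qq' : 0 < q%:R :> R by rewrite ltr0n.
have lo : q0%:R * p%:~R < q%:R * p0%:~R :> R.
  by rewrite -E mulrCA ltr_pM2l.
have up : q%:R * p0%:~R < q0%:R * p%:~R + 1 :> R.
  have : q0%:R * (q%:R * a) < q0%:R * (p%:~R + r) by rewrite ltr_pM2l.
  rewrite mulrCA E mulrDr => /lt_le_trans; apply; rewrite lerD2l.
  apply: (@le_trans _ _ (q0%:R * (q0.+1%:R * q%:R)^-1)); first by rewrite ler_pM2l.
  rewrite ler_pdivrMr ?mulr_gt0// mul1r -natrM ler_nat.
  by rewrite mulSn (leq_trans _ (leq_addl _ _))// leq_pmulr.
move: lo up; rewrite -[q0%:R]/(q0%:Z%:~R) -[q%:R]/(q%:Z%:~R) -!intrM.
by rewrite -[X in _ + X]/(1%:~R) -intrD !ltr_int ltzD1 => lo /(lt_le_trans lo); rewrite ltxx.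
Qed.

Lemma liouville_not_ac N a t h : (forall n, liouville N n a) -> lift h ->
  (forall x, h (model (amplitude m eps N) N t x) = h x + a) ->
  ~ locally_abs_continuous (fun x => h x - x).
Proof.
move=> H hl hf; apply: not_abs_continuous => d d0.
pose n := Num.truncn d^-1.
have nd : n.+1%:R^-1 <= d.
  by rewrite -[leRHS]invrK lef_pV2 ?posrE ?invr_gt0// ltW// truncnS_gt.
have [q [p [r [_ _ s pa ap]]]] := H n.
have [M [B [M0 Bn hB]]] := s a t h hl hf pa ap.
exists M, B; split=> //; apply: lt_le_trans Bn _.
by rewrite ler_wpM2r.
Qed.

Lemma liouville_residual :
  @residual_in R `[0, 1]%classic
    [set a | 0 <= a <= 1 /\ forall N n, liouville N.+1 n a].
Proof.
split; first by move=> a [a01 _]; rewrite /= in_itv.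
(* The pairs [(N, n)] are enumerated by their codes; a number that codes no pair contributes the
   whole line. *)
exists (fun k => if unpickle k is Some Nn then liouville (Nn : nat * nat).1.+1 Nn.2
   else setT).
split.
- by move=> k; case: unpickle => [[N n]|]; [exact: liouville_open|exact: openT].
- move=> k; case: unpickle => [[N n]|]; first exact: liouville_dense.
  by rewrite setTI; exact: subset_closure.
- move=> a [aU]; rewrite /= in_itv /= => a01; split=> // N n.
  by have := aU (pickle (N, n)) I; rewrite pickleK.
Qed.

(** With [P = N^(eps/2)] one has [b N^m = P / 1000]. The fractional norm is then at most [K / P],
    while a [C^(m+1)] norm below [delta] would force [P <= 40000 delta]. The two entries of the
    maximum below decide these two comparisons. *)
Lemma Cnorm_window (delta : R) : 0 < delta -> exists N0 : nat,
  forall (N : nat) t p, (0 < N)%N -> (N0 <= N)%N ->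
    39 / 100 <= N%:R * t - p%:~R <= 61 / 100 ->
    U_ (m.+1%:R - eps) delta (Phi (model (amplitude m eps N) N t)) /\
    ~ U_ m.+1%:R delta (Phi (model (amplitude m eps N) N t)).
Proof.
move=> delta0.
pose K : R := m.+2%:R * derivative_bound R m * 1000^-1.
have e2 : 0 < eps / 2 by rewrite divr_gt0.
have [N0 N0P] := @powR_large (eps / 2) (Num.max (K / delta) (40 * 1000 * delta)) e2.
exists N0 => N t p Ngt0 /N0P; rewrite gt_max => /andP[P1 P2] tp.
have b0 := amplitude_gt0 Ngt0; have bs := amplitude_small Ngt0.
have N0' : 0 < N%:R :> R by rewrite ltr0n.
set P := N%:R `^ (eps / 2) in P1 P2.
have P0 : 0 < P by rewrite powR_gt0.
have Nm : 0 < N%:R ^+ m :> R by rewrite exprn_gt0.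
have bN : amplitude m eps N * N%:R ^+ m = 1000^-1 * P.
  by rewrite /amplitude -mulrA divfK ?gt_eqF.
split.
  split; first exact: Phi_model_smooth_circle.
  apply: le_lt_trans (Cnorm_Phi_model_le t b0 bs Ngt0 m eps_gt0 eps_lt1) _.
  rewrite lte_fin.
  have PPN : N%:R `^ (1 - eps) * (P * P) = N%:R.
    have nz (c : R) : (c == 0) ==> (N%:R != 0 :> R) by rewrite (gt_eqF N0') implybT.
    rewrite -(powRD (nz _)) -(powRD (nz _)).
    have -> : 1 - eps + (eps / 2 + eps / 2) = 1 by lra.
    by rewrite powRr1.
  have -> : N%:R `^ (1 - eps) = N%:R / (P * P).
    by rewrite -[in RHS]PPN mulfK// mulf_neq0// gt_eqF.
  have -> : m.+2%:R * derivative_bound R m * amplitude m eps N * (N%:R ^+ m / N%:R)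
      * (N%:R / (P * P)) = m.+2%:R * derivative_bound R m
        * (amplitude m eps N * N%:R ^+ m) / P * (N%:R / N%:R) / P.
    by rewrite invfM; lra.
  rewrite bN divff ?gt_eqF// mulr1.
  have -> : m.+2%:R * derivative_bound R m * (1000^-1 * P) / P / P = K / P.
    by rewrite [_ * (_ * P)]mulrA mulfK ?gt_eqF// /K mulrA.
  by rewrite ltr_pdivrMr// mulrC -ltr_pdivrMr.
move=> [_ /(Cnorm_Phi_model_ge b0 bs Ngt0 tp)]; rewrite bN ler_pdivrMl ?ltr0n//.
by move: P2; lra.
Qed.

End Amplitude.
End Residual.

Theorem theorem2 (R : realType) :
  exists eps0 : R, (0 < eps0 /\ eps0 < 1) /\
    forall eps : R, 0 < eps -> eps < eps0 ->
    forall iota : nat, (2 <= iota)%N ->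
    exists Res : set R, @residual_in R `[0, 1]%classic Res /\
      forall alpha : R, Res alpha ->
      forall delta : R, 0 < delta ->
        (U_ (iota%:R - eps) delta `\` U_ iota%:R delta) `&`
        ((@Phi R @` O_omega_0 alpha) `\` (@Phi R @` O_omega_ac alpha)) !=set0.
Proof.
exists 2^-1; split; first by split; lra.
move=> eps eps_gt0 eps_lt [//|[//|k]] _; set m := k.+1.
have eps_lt1 : eps < 1 by lra.
exists [set a | 0 <= a <= 1 /\ forall N n, liouville m eps N.+1 n a].
split; first exact: liouville_residual.
move=> a [_ aL] delta delta0.
have ia : irrational a := liouville_irrational (aL 0%N).
have [N0 N0P] := Cnorm_window (isT : (0 < m)%N) eps_gt0 eps_lt1 delta0.
(* [N t] differs from [N a] by at most [5 b <= 1/200], so this window for [N a] puts [N t] in the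
   one from 39/100 to 61/100. *)
have w : 2 / 5 < 3 / 5 :> R by lra.
have [N [p [NN0 Nap]]] := orbit_dense N0.+1 ia w.
have Ngt0 : (0 < N)%N by apply: leq_trans NN0.
have b0 := amplitude_gt0 m eps Ngt0.
have bs := amplitude_small (isT : (0 < m)%N) eps_lt1 Ngt0.
have [t [h [hl hf]]] := model_conjugate b0 bs Ngt0 ia.
have fl := model_lift b0 bs Ngt0 t.
have close := model_rotation_close b0 bs Ngt0 hl hf.
have tp : 39 / 100 <= N%:R * t - p%:~R <= 61 / 100.
  by move: close; rewrite ler_norml; move: bs; lra.
have [inU notinU] := N0P N t p Ngt0 (ltnW NN0) tp.
set g := model _ N t in inU notinU fl hf *.
have gO : O_omega_0 a g.
  split; first by apply/(conj_rotationsP _ _ (fun _ => id)); exists h; split=> //; exact: lift_D0.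
  split; last exact: conj_rotation_number hl hf.
  split; [exact: lift_D0|exact: model_analytic|exact: inverse_model_analytic].
exists (Phi g); split; first exact: conj inU notinU.
split; first by exists g.
move=> [g' [cg' [[Dg' _ _] _]] g'E].
have /conj_rotationsP : @D_ac R `<=` @D_0 R by move=> h' [].
move=> /(_ a g')[/(_ cg') [h' [[_ h'ac] h'l h'g']] _].
(* The competitor comes with its own conjugacy [h']. Once [g' = g], the singularity statement
   applies to [h'], since it holds for every conjugacy. *)
have E : g' = g := Phi_inj ia (D0_lift Dg') fl h'l hl h'g' hf g'E.
have aLN n : liouville m eps N n a by rewrite -(prednK Ngt0); exact: aL.
by apply: (liouville_not_ac (t := t) aLN h'l _ h'ac) => x; rewrite -/g -E.
Qed.
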